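(* Let $K$ be a field of characteristic $0$, $n\ge1$, and let $$\Phi=\sum_{k=0}^{\left[\frac{n+1}{2}\right]}\frac{1}{(2^kk!)^2(n+1-2k)!}\,\Sigma(n+1)\,E(k)\,\Sigma(n+1)\in B_{n+1}^{n+1}(-2n),$$ where $\Sigma(n+1)=\sum_{\sigma\in\mathrm{Sym}_{n+1}}\sigma$ and $E(k)=\prod_{j=1}^ke_{n+2-2j}$ ($E(0)=1$). Then $\Phi/(n+1)!$ is the central idempotent in the Brauer algebra $B_{n+1}^{n+1}(-2n)$ which corresponds to the trivial representation $\rho_1$ of $B_{n+1}^{n+1}(-2n)$, defined by $\rho_1(s_i)=1$ and $\rho_1(e_i)=0$ for all $i$. It generates a $1$-dimensional two-sided ideal of $B_{n+1}^{n+1}(-2n)$.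
   Context: An $(r,r)$ Brauer diagram is a partition into pairs (arcs) of $r$ lower nodes and $r$ upper nodes (each row numbered left to right). The Brauer algebra $B_r^r(\delta)$ has $K$-basis the $(r,r)$ diagrams, with product $D_1D_2=\delta^fD$ obtained by placing $D_1$ above $D_2$, identifying middle nodes and deleting the $f$ closed loops. $s_i$ ($1\le i\le r-1$) is the diagram joining lower $i$ to upper $i+1$, lower $i+1$ to upper $i$, and lower $j$ to upper $j$ for $j\ne i,i+1$; $e_i$ joins lower $i$ to lower $i+1$, upper $i$ to upper $i+1$, and lower $j$ to upper $j$ for $j\neq i,i+1$. The $s_i$ generate a subalgebra identified with $K\mathrm{Sym}_r$. $[x]$ denotes integer part. *)

(* Defs.v *)
From HB Require Import structures.
From mathcomp Require Import all_boot fingroup perm all_algebra falgebra.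
From mathcomp Require Import zify.

Set Implicit Arguments.
Unset Strict Implicit.
Unset Printing Implicit Defensive.

Import GRing.Theory.

(* Nodes of an (r, r) diagram: [inl i] is an upper node, [inr i] a lower one.
   Positions in a row are numbered from 0. *)
Definition node (r : nat) : finType := ('I_r + 'I_r)%type.

(* A partition of the nodes into pairs, encoded by the map sending a node to
   the other end of its arc, i.e. by a fixed-point-free involution. *)
Definition matching r (f : {ffun node r -> node r}) : bool :=
  [forall x, (f x != x) && (f (f x) == x)].

Record diagram (r : nat) := Diagram {
  partner :> {ffun node r -> node r};
  partnerP : matching partner
}.

HB.instance Definition _ r := [isSub for @partner r].
HB.instance Definition _ r := [Finite of diagram r by <:].

Section Diagram.
Variable r : nat.
Implicit Type D : diagram r.

Lemma partner_neq D x : D x != x.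
Proof. by have /forallP/(_ x)/andP[] := partnerP D. Qed.

Lemma partnerK D : involutive D.
Proof. by move=> x; have /forallP/(_ x)/andP[_ /eqP] := partnerP D. Qed.

Lemma diagramP D1 D2 : D1 =1 D2 -> D1 = D2.
Proof. by move=> eqD; apply/val_inj/ffunP. Qed.

Lemma matching_ffun (f : node r -> node r) :
  (forall x, f x != x) -> involutive f -> matching [ffun x => f x].
Proof. by move=> nf fK; apply/forallP => x; rewrite !ffunE nf fK eqxx. Qed.

(* Lower i is joined to upper s i. *)
Definition perm_fun (s : 'S_r) (x : node r) : node r :=
  match x with inl i => inr (s^-1%g i) | inr i => inl (s i) end.

Lemma perm_fun_neq s x : perm_fun s x != x. Proof. by case: x. Qed.

Lemma perm_funK s : involutive (perm_fun s).
Proof. by case=> i /=; rewrite ?permK ?permKV. Qed.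

Definition perm_diagram s : diagram r :=
  Diagram (matching_ffun (perm_fun_neq s) (@perm_funK s)).

Definition id_diagram : diagram r := perm_diagram 1%g.

(* For a != b: a and b are joined to each other in each of the two rows, and
   all other arcs are vertical. *)
Definition cupcap_fun (a b : 'I_r) (x : node r) : node r :=
  match x with
  | inl i => if tperm a b i == i then inr i else inl (tperm a b i)
  | inr i => if tperm a b i == i then inl i else inr (tperm a b i)
  end.

Lemma cupcap_fun_neq a b x : cupcap_fun a b x != x.
Proof. by case: x => i /=; case: ifPn. Qed.

Lemma cupcap_funK a b : involutive (cupcap_fun a b).
Proof.
by case=> i /=; case: ifPn => /= h; rewrite ?tpermK ?h // (eq_sym i) (negPf h).
Qed.

Definition cupcap_diagram a b : diagram r :=
  Diagram (matching_ffun (cupcap_fun_neq a b) (@cupcap_funK a b)).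

(* Nodes of the picture with D1 above D2: [inl x] is the node x of the outer
   rows, [inr i] is a node of the row obtained by identifying the lower row of
   D1 with the upper row of D2. *)
Definition node3 : finType := (node r + 'I_r)%type.

Definition above (x : node r) : node3 :=
  match x with inl i => inl (inl i) | inr i => inr i end.

Definition below (x : node r) : node3 :=
  match x with inl i => inr i | inr i => inl (inr i) end.

Definition arc (T : finType) (f : node r -> T) D : rel T :=
  fun x y => [exists u, (x == f u) && (y == f (D u))].

Definition stacked D1 D2 : rel node3 :=
  fun x y => arc above D1 x y || arc below D2 x y.

Definition compose_fun D1 D2 (x : node r) : node r :=
  odflt x
    [pick y | (y != x) && connect (stacked D1 D2) (inl x) (inl y)].

(* Number of connected components which stay in the middle row. *)
Definition loops D1 D2 : nat :=
  n_comp (stacked D1 D2)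
    [pred x | [forall y, ~~ connect (stacked D1 D2) x (inl y)]].

(* The composite is a diagram: each connected component of the stacked
   picture is a cycle or a path between two outer nodes. *)
Section Dihedral.
Variables (T : finType) (a b : T -> T).
Hypotheses (aK : involutive a) (bK : involutive b).
Hypothesis nab : forall z, a z = z -> b z = z -> False.
Let e : rel T := [rel x y | (a x == y) || (b x == y)].
Let p z := b (a z).

Lemma dihedral_path x : b x = x ->
  exists y, [/\ y != x, (a y = y) \/ (b y = y), connect e x y &
    forall z, connect e x z -> (a z = z) \/ (b z = z) -> z = x \/ z = y].
Proof.
move=> bx.
have p_inj : injective p.
  by apply: inj_comp; [exact: (inv_inj bK) | exact: (inv_inj aK)].
have it_inj m : injective (iter m p).
  by elim: m => [|m IH] u v //= /p_inj /IH.
have pb i z : iter i p (b (iter i p z)) = b z.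
  by elim: i z => //= i IH z; rewrite -iterS iterSr /p bK aK IH.
set N := fingraph.order p x.
have N0 : 0 < N by apply: fingraph.order_gt0.
have pN : iter N p x = x by apply: fingraph.iter_order.
have per m : m < N.*2 -> iter m p x = x -> m = 0 \/ m = N.
  move=> m2 pm; case: (ltnP m N) => mN.
    by left; rewrite -(findex_iter mN) pm findex0.
  right; have mN' : m - N < N by lia.
  have : iter (m - N) p x = x.
    by rewrite -{1}pN -iterD subnK.
  by move=> /(congr1 (findex p x)); rewrite findex_iter // findex0; lia.
have cl z : connect e x z -> fconnect p x z.
  have clb w : fconnect p x w -> fconnect p x (b w).
    move=> /iter_findex <-; set i := findex _ _ _.
    rewrite fconnect_sym // -{2}bx -(pb i x); exact: fconnect_iter.
  have clx : closed e (fconnect p x).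
    apply: intro_closed => [|u v].
      apply: sym_connect_sym => u v /=.
      by rewrite /e /= (inv_eq aK) (inv_eq bK) ![u == _]eq_sym.
    rewrite /e /= => /orP[]/eqP <-; last exact: clb.
    rewrite !inE => xu; rewrite -[a u]bK; apply: clb.
    by apply: connect_trans xu _; exact: fconnect1.
  by move=> /(closed_connect clx); rewrite !inE connect0 => <-.
have lc i : connect e x (iter i p x).
  elim: i => [|i IH]; first exact: connect0.
  apply: (connect_trans IH); apply: (@connect_trans _ _ (a (iter i p x))).
    by apply: connect1; rewrite /e /= eqxx.
  by apply: connect1; rewrite /e /= eqxx orbT.
have N1 : 1 < N.
  rewrite ltn_neqAle N0 andbT; apply/eqP => N1; move: pN; rewrite -N1 /= /p => bax.
  by apply: (@nab x) => //; apply: (inv_inj bK); rewrite bax.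
exists (iter N./2 p x); split=> //.
- apply/eqP => /per[]; first lia.
  + by move=> h; move: N1 (odd_double_half N); lia.
  + by move=> h; move: N1 (odd_double_half N); lia.
- have := odd_double_half N; case: (odd N) => hN.
    left; apply: (it_inj N./2.+1).
    rewrite -[a _]bK -/(p _) -iterS pb bx -iterD addSn addnn.
    by rewrite (_ : _.+1 = N) ?pN //; lia.
  right; apply: (it_inj N./2); rewrite pb bx -iterD addnn.
  by rewrite (_ : _.*2 = N) ?pN.
- move=> z /cl xz; have iN := findex_max xz; move: (iter_findex xz).
  move: (findex p x z) iN => i iN <- [az|bz].
    have : iter (i.+1 + i) p x = x.
      have ai : iter i p x = b (iter i.+1 p x) by rewrite iterS /p bK az.
      by rewrite iterD {1}ai pb.
    move=> /per[]; [lia|lia|move=> h; right].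
    by congr (iter _ p _); lia.
  have : iter (i + i) p x = x by rewrite iterD -{1}bz pb.
  move=> /per[]; first lia; move=> h; [left|right].
    by rewrite (_ : i = 0) //; lia.
  by congr (iter _ p _); lia.
Qed.
End Dihedral.

Lemma arc_sym (T : finType) (f : node r -> T) D : symmetric (arc f D).
Proof.
move=> x y; apply/existsP/existsP => -[u /andP[/eqP-> /eqP->]];
  by exists (D u); rewrite partnerK !eqxx.
Qed.

Lemma arcI (T : finType) (f : node r -> T) D u : arc f D (f u) (f (D u)).
Proof. by apply/existsP; exists u; rewrite !eqxx. Qed.

Lemma stacked_sym D1 D2 : symmetric (stacked D1 D2).
Proof. by move=> x y; rewrite /stacked !(arc_sym _ _ x). Qed.

Lemma stacked_csym D1 D2 : connect_sym (stacked D1 D2).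
Proof. by apply: sym_connect_sym; apply: stacked_sym. Qed.

Local Definition move1 D (z : node3) : node3 :=
  match z with
  | inl (inl i) => above (D (inl i)) | inr i => above (D (inr i)) | _ => z
  end.
Local Definition move2 D (z : node3) : node3 :=
  match z with
  | inl (inr i) => below (D (inr i)) | inr i => below (D (inl i)) | _ => z
  end.

Local Lemma move1_above D u : move1 D (above u) = above (D u).
Proof. by case: u. Qed.
Local Lemma move2_below D u : move2 D (below u) = below (D u).
Proof. by case: u. Qed.

Local Lemma above_inj : injective above.
Proof. by case=> i [] j // [->]. Qed.
Local Lemma below_inj : injective below.
Proof. by case=> i [] j // [->]. Qed.

Local Lemma move1P D z : (exists2 u, z = above u & move1 D z = above (D u))
  \/ (exists2 i, z = inl (inr i) & move1 D z = z).
Proof.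
case: z => [[]|] i; [left; exists (inl i) | right; exists i | left; exists (inr i)];
by [].
Qed.
Local Lemma move2P D z : (exists2 u, z = below u & move2 D z = below (D u))
  \/ (exists2 i, z = inl (inl i) & move2 D z = z).
Proof.
case: z => [[]|] i; [right; exists i | left; exists (inr i) | left; exists (inl i)];
by [].
Qed.

Local Lemma move1K D : involutive (move1 D).
Proof.
move=> z; case: (move1P D z) => -[u -> ->]; last by [].
by rewrite move1_above partnerK.
Qed.
Local Lemma move2K D : involutive (move2 D).
Proof.
move=> z; case: (move2P D z) => -[u -> ->]; last by [].
by rewrite move2_below partnerK.
Qed.

Local Lemma move1F D z : (move1 D z == z) = (if z is inl (inr _) then true else false).
Proof.
case: (move1P D z) => -[u -> ->]; last by rewrite eqxx.
by rewrite (inj_eq above_inj) (negPf (partner_neq D u)); case: u.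
Qed.
Local Lemma move2F D z : (move2 D z == z) = (if z is inl (inl _) then true else false).
Proof.
case: (move2P D z) => -[u -> ->]; last by rewrite eqxx.
by rewrite (inj_eq below_inj) (negPf (partner_neq D u)); case: u.
Qed.

Local Lemma stacked_move D1 D2 :
  connect (stacked D1 D2)
  =2 connect [rel x y | (move1 D1 x == y) || (move2 D2 x == y)].
Proof.
move=> x y; apply/idP/idP; apply: connect_sub => {x y} x y /=.
  case/orP => /existsP[u /andP[/eqP-> /eqP->]]; apply: connect1 => /=.
    by rewrite move1_above eqxx.
  by rewrite move2_below eqxx orbT.
case/orP => /eqP <-.
  case: (move1P D1 x) => -[u -> ->]; last exact: connect0.
  by apply: connect1; rewrite /stacked arcI.
case: (move2P D2 x) => -[u -> ->]; last exact: connect0.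
by apply: connect1; rewrite /stacked arcI orbT.
Qed.

Lemma stacked_path D1 D2 x : exists2 y, y != x &
  forall z, connect (stacked D1 D2) (inl x) (inl z) = (z == x) || (z == y).
Proof.
have fixE z : (exists x, z = inl x) <-> move1 D1 z = z \/ move2 D2 z = z.
  split.
    case=> -[] i ->; [right|left]; apply/eqP; rewrite ?move1F ?move2F //.
  by case=> /eqP; rewrite ?move1F ?move2F; case: z => // t _; exists t.
have nfix z : move1 D1 z = z -> move2 D2 z = z -> False.
  by move=> /eqP + /eqP; rewrite move1F move2F; case: z => // -[].
have [y [yx yF xy yU]] : exists y, [/\ y != inl x,
    move1 D1 y = y \/ move2 D2 y = y,
    connect (stacked D1 D2) (inl x) y &
    forall z, connect (stacked D1 D2) (inl x) z ->
      move1 D1 z = z \/ move2 D2 z = z -> z = inl x \/ z = y].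
  have /fixE : exists t, inl x = inl t :> node3 by exists x.
  case=> [h|h].
    have := @dihedral_path _ _ _ (@move2K D2) (@move1K D1)
      (fun z h1 h2 => nfix z h2 h1) _ h.
    have E : connect (stacked D1 D2) =2
       connect [rel x y | (move2 D2 x == y) || (move1 D1 x == y)].
      by move=> u v; rewrite stacked_move; apply: eq_connect => u' v' /=; rewrite orbC.
    case=> y [yx yF xy yU]; exists y; split=> //; first by case: yF; [right|left].
      by rewrite E.
    by move=> z; rewrite E => /yU h1 h2; apply: h1; case: h2; [right|left].
  have := @dihedral_path _ _ _ (@move1K D1) (@move2K D2) nfix _ h.
  case=> y [yx yF xy yU]; exists y; split=> //; first by rewrite stacked_move.
  by move=> z; rewrite stacked_move; apply: yU.
case/fixE: yF => y' ey; subst y.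
exists y' => // z; apply/idP/idP.
  move=> /yU; case; first by apply/fixE; exists z.
    by case=> ->; rewrite eqxx.
  by case=> ->; rewrite eqxx orbT.
by case/orP => /eqP->; rewrite ?connect0.
Qed.

Lemma compose_funP D1 D2 x : compose_fun D1 D2 x != x /\
  forall z, connect (stacked D1 D2) (inl x) (inl z)
    = (z == x) || (z == compose_fun D1 D2 x).
Proof.
have [y yx yP] := stacked_path D1 D2 x.
suff -> : compose_fun D1 D2 x = y by [].
rewrite /compose_fun; case: pickP => [z /andP[zx]|/(_ y)].
  by rewrite yP (negPf zx) => /eqP.
by rewrite yx yP eqxx orbT.
Qed.

Lemma compose_fun_neq D1 D2 x : compose_fun D1 D2 x != x.
Proof. by case: (compose_funP D1 D2 x). Qed.

Lemma compose_funK D1 D2 : involutive (compose_fun D1 D2).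
Proof.
move=> x; set y := compose_fun D1 D2 x.
have [yx xP] := compose_funP D1 D2 x; have [_ yP] := compose_funP D1 D2 y.
have : connect (stacked D1 D2) (inl y) (inl x).
  by rewrite stacked_csym xP eqxx orbT.
by rewrite yP eq_sym (negPf yx) => /eqP.
Qed.

Definition compose D1 D2 : diagram r :=
  Diagram (matching_ffun (compose_fun_neq D1 D2) (@compose_funK D1 D2)).

Lemma composeP D1 D2 x z : connect (stacked D1 D2) (inl x) (inl z)
  = (z == x) || (z == compose D1 D2 x).
Proof. by rewrite ffunE; case: (compose_funP D1 D2 x). Qed.

Lemma compose_uniq D1 D2 x z :
  z != x -> connect (stacked D1 D2) (inl x) (inl z) -> compose D1 D2 x = z.
Proof. by rewrite composeP => /negPf-> /eqP. Qed.


(* The mirror image of a diagram in a horizontal line, used to deduce one side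
   of a statement from the other. *)
Definition swap (x : node r) : node r :=
  match x with inl i => inr i | inr i => inl i end.

Lemma swapK : involutive swap. Proof. by case. Qed.

Lemma flip_neq D x : swap (D (swap x)) != x.
Proof. by rewrite (inv_eq swapK) partner_neq. Qed.

Lemma flipK D : involutive (fun x => swap (D (swap x))).
Proof. by move=> x; rewrite swapK partnerK swapK. Qed.

Definition flip D : diagram r :=
  Diagram (matching_ffun (flip_neq D) (@flipK D)).

Lemma flipE D x : flip D x = swap (D (swap x)). Proof. by rewrite ffunE. Qed.

Lemma flip_inv : involutive flip.
Proof. by move=> D; apply: diagramP => x; rewrite !flipE !swapK. Qed.

Lemma arc_map (T T' : finType) (h : T -> T') (f : node r -> T) D x y :
  arc f D x y -> arc (h \o f) D (h x) (h y).
Proof. by case/existsP=> u /andP[/eqP-> /eqP->]; apply: (@arcI _ (h \o f)). Qed.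

Lemma arc_map_inj (T T' : finType) (h : T -> T') (f : node r -> T) D x y :
  injective h -> arc (h \o f) D (h x) (h y) = arc f D x y.
Proof. by move=> hI; apply: eq_existsb => u; rewrite /= !(inj_eq hI). Qed.

Lemma eq_arc (T : finType) (f g : node r -> T) D x y :
  f =1 g -> arc f D x y = arc g D x y.
Proof. by move=> fg; apply: eq_existsb => u; rewrite !fg. Qed.

Lemma arc_flip (T : finType) (f : node r -> T) D x y :
  arc f (flip D) x y = arc (f \o swap) D x y.
Proof.
apply/existsP/existsP => -[u /andP[/eqP-> /eqP->]]; exists (swap u);
  by rewrite /= ?flipE swapK !eqxx.
Qed.

Lemma connect_iso (T : finType) (h : T -> T) (e e' : rel T) :
  involutive h -> (forall x y, e' (h x) (h y) = e x y) ->
  forall x y, connect e' (h x) (h y) = connect e x y.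
Proof.
move=> hK ee'; have hom (f f' : rel T) :
    (forall x y, f x y -> f' (h x) (h y)) ->
    forall x y, connect f x y -> connect f' (h x) (h y).
  move=> ff' x y /connectP[p + ->]; elim: p x => [|z p IH] x /=.
    by move=> _; apply: connect0.
  case/andP=> xz /IH; apply: connect_trans; apply: connect1; exact: ff'.
move=> x y; apply/idP/idP; last by apply: hom => {}x {}y; rewrite ee'.
rewrite -{2}(hK x) -{2}(hK y); apply: hom => {}x {}y.
by rewrite -{1}(hK x) -{1}(hK y) ee'.
Qed.

Lemma n_comp_iso (T : finType) (h : T -> T) (e e' : rel T) (a a' : pred T) :
  involutive h -> symmetric e -> symmetric e' ->
  (forall x y, e' (h x) (h y) = e x y) -> (forall x, a' (h x) = a x) ->
  closed e' a' -> n_comp e' a' = n_comp e a.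
Proof.
move=> hK se se' ee' aa' cl.
rewrite (adjunction_n_comp h (sym_connect_sym se') (sym_connect_sym se) cl).
  by apply: eq_n_comp_r => x; apply: aa'.
split=> [x _|x y _]; first by exists (h x); rewrite hK connect0.
by rewrite (connect_iso hK ee').
Qed.

Lemma closed_avoid (T : finType) (e : rel T) (b : node r -> T) :
  symmetric e -> closed e [pred x | [forall y, ~~ connect e x (b y)]].
Proof.
move=> se; apply: intro_closed; first exact: sym_connect_sym.
move=> x y xy; rewrite !inE => /forallP h; apply/forallP => z.
apply: contra (h z); apply: connect_trans; exact: connect1.
Qed.

Definition mirror3 (z : node3) : node3 :=
  match z with inl x => inl (swap x) | inr i => inr i end.

Lemma mirror3K : involutive mirror3. Proof. by case=> // x /=; rewrite swapK. Qed.

Lemma stacked_flip D1 D2 x y :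
  stacked (flip D2) (flip D1) (mirror3 x) (mirror3 y) = stacked D1 D2 x y.
Proof.
rewrite /stacked !arc_flip -!(arc_map_inj _ _ x y (inv_inj mirror3K)).
have E1 : above \o swap =1 mirror3 \o below by case.
have E2 : below \o swap =1 mirror3 \o above by case.
by rewrite (eq_arc _ _ _ E1) (eq_arc _ _ _ E2) orbC.
Qed.

Lemma compose_flip D1 D2 :
  compose (flip D2) (flip D1) = flip (compose D1 D2).
Proof.
apply: diagramP => x; rewrite flipE; apply: compose_uniq.
  by rewrite (inv_eq swapK) partner_neq.
have := connect_iso mirror3K (stacked_flip D1 D2) (inl (swap x))
  (inl (compose D1 D2 (swap x))).
by rewrite /= swapK => ->; rewrite composeP eqxx orbT.
Qed.

Lemma loops_flip D1 D2 : loops (flip D2) (flip D1) = loops D1 D2.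
Proof.
apply: (n_comp_iso mirror3K (@stacked_sym D1 D2)); try exact: stacked_sym.
- exact: stacked_flip.
- move=> x /=; apply/forallP/forallP => h y; move: (h (swap y));
  have := connect_iso mirror3K (stacked_flip D1 D2) x (inl y);
  have := connect_iso mirror3K (stacked_flip D1 D2) x (inl (swap y));
  by rewrite /= swapK => E1 E2; rewrite ?E1 ?E2.
- exact/closed_avoid/stacked_sym.
Qed.

Section Assoc.

Definition node4 : finType := (node r + ('I_r + 'I_r))%type.

Local Definition top3 (z : node3) : node4 :=
  match z with
  | inl (inl i) => inl (inl i) | inr i => inr (inl i)
  | inl (inr i) => inr (inr i)
  end.
Local Definition bot3 (z : node3) : node4 :=
  match z with inl x => inl x | inr i => inr (inr i) end.

Local Lemma k_inj : injective top3. Proof. by case=> [[]|] i [[]|] l // [->]. Qed.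
Local Lemma j_inj : injective bot3. Proof. by case=> i [] l // [->]. Qed.
Local Lemma jk u : bot3 (above u) = top3 (inl u). Proof. by case: u. Qed.
Local Lemma jk_inv x t : bot3 x = top3 t -> exists2 u, x = above u & t = inl u.
Proof.
case: x t => [[]|] i [[]|] l // [->]; by [exists (inl l) | exists (inr l)].
Qed.

Definition stacked4 D1 D2 D3 : rel node4 := fun x y =>
  [|| arc (top3 \o above) D1 x y, arc (top3 \o below) D2 x y
    | arc (bot3 \o below) D3 x y].

Lemma stacked4_sym D1 D2 D3 : symmetric (stacked4 D1 D2 D3).
Proof. by move=> x y; rewrite /stacked4 !(arc_sym _ _ x). Qed.

Lemma stacked4_csym D1 D2 D3 : connect_sym (stacked4 D1 D2 D3).
Proof. by apply: sym_connect_sym; apply: stacked4_sym. Qed.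

Local Definition mirror4 (z : node4) : node4 :=
  match z with
  | inl x => inl (swap x) | inr (inl i) => inr (inr i) | inr (inr i) => inr (inl i)
  end.

Local Lemma mirror4K : involutive mirror4.
Proof. by case=> [x|[]] //=; rewrite swapK. Qed.

Lemma stacked4_flip D1 D2 D3 x y :
  stacked4 (flip D3) (flip D2) (flip D1) (mirror4 x) (mirror4 y)
    = stacked4 D1 D2 D3 x y.
Proof.
rewrite /stacked4 !arc_flip -!(arc_map_inj _ _ x y (inv_inj mirror4K)).
have E1 : (bot3 \o below) \o swap =1 mirror4 \o (top3 \o above) by case.
have E2 : (top3 \o below) \o swap =1 mirror4 \o (top3 \o below) by case.
have E3 : (top3 \o above) \o swap =1 mirror4 \o (bot3 \o below) by case.
rewrite (eq_arc _ _ _ E1) (eq_arc _ _ _ E2) (eq_arc _ _ _ E3).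
by do 3!case: (arc _ _ _ _).
Qed.

Section Fixed.
Variables D1 D2 D3 : diagram r.
Local Notation e3 := (stacked D1 D2).
Local Notation e4 := (stacked4 D1 D2 D3).
Local Notation e' := (stacked (compose D1 D2) D3).

Local Lemma c34 x y : connect e3 x y -> connect e4 (top3 x) (top3 y).
Proof.
move=> /connectP[p + ->]; elim: p x => [|z p IH] x /=.
  by move=> _; apply: connect0.
case/andP=> xz /IH; apply: connect_trans; apply: connect1.
by move: xz => /orP[] h; rewrite /stacked4 (arc_map top3 h) ?orbT.
Qed.

Local Lemma c'4 x y : connect e' x y -> connect e4 (bot3 x) (bot3 y).
Proof.
move=> /connectP[p + ->]; elim: p x => [|z p IH] x /=.
  by move=> _; apply: connect0.
case/andP=> xz /IH; apply: connect_trans.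
move: xz => /orP[]; last first.
  by move=> h; apply: connect1; rewrite /stacked4 (arc_map bot3 h) !orbT.
by case/existsP=> u /andP[/eqP-> /eqP->]; rewrite !jk c34 // composeP eqxx orbT.
Qed.

Local Definition reach x w := (exists2 x', bot3 x' = w & connect e' x x') \/
  (exists u t, [/\ top3 t = w, connect e' x (above u) & connect e3 (inl u) t]).

Local Lemma reach_k x t : reach x (top3 t) ->
  exists2 u, connect e' x (above u) & connect e3 (inl u) t.
Proof.
case=> [[x' /jk_inv[u -> ->] h]|[u [t' [/k_inj <-]]]]; exists u => //.
Qed.

Local Lemma reach_j x y : reach x (bot3 y) -> connect e' x y.
Proof.
case=> [[x' /j_inj <-] //|[u [t [/esym/jk_inv[u' -> ->] h]]]].
rewrite composeP => /orP[]/eqP-> //; apply: connect_trans h _.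
by apply: connect1; rewrite /stacked arcI.
Qed.

Local Lemma reachP x w : connect e4 (bot3 x) w -> reach x w.
Proof.
case/connectP=> p; elim/last_ind: p w => [|p z IH] w /=.
  by move=> _ ->; left; exists x.
rewrite rcons_path last_rcons => /andP[/IH{}IH + ->].
move: (last _ _) (IH _ erefl) => v rv {IH w}.
case/or3P=> /existsP[u /andP[/eqP ev /eqP->]]; move: rv; rewrite ev /=.
- case/reach_k=> u' h1 h2; right; exists u', (above (D1 u)); split=> //.
  by apply: connect_trans h2 _; apply: connect1; rewrite /stacked arcI.
- case/reach_k=> u' h1 h2; right; exists u', (below (D2 u)); split=> //.
  by apply: connect_trans h2 _; apply: connect1; rewrite /stacked arcI orbT.
- move/reach_j=> h; left; exists (below (D3 u)) => //.
  by apply: connect_trans h _; apply: connect1; rewrite /stacked arcI orbT.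
Qed.

Lemma connect4 x y : connect e4 (bot3 x) (bot3 y) = connect e' x y.
Proof. by apply/idP/idP => [/reachP/reach_j|/c'4]. Qed.

Local Lemma inner4 x w : (forall y, ~~ connect e3 x (inl y)) ->
  connect e4 (top3 x) w -> exists2 t, top3 t = w & connect e3 x t.
Proof.
move=> hx /connectP[p]; elim/last_ind: p w => [|p z IH] w /=.
  by move=> _ ->; exists x.
rewrite rcons_path last_rcons => /andP[/IH{}IH + ->].
move: (last _ _) (IH _ erefl) => v [t <- xt] {IH w}.
case/or3P=> /existsP[u /andP[/eqP ev /eqP->]].
- exists (above (D1 u)) => //; move/k_inj: ev xt => -> h.
  by apply: connect_trans h _; apply: connect1; rewrite /stacked arcI.
- exists (below (D2 u)) => //; move/k_inj: ev xt => -> h.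
  by apply: connect_trans h _; apply: connect1; rewrite /stacked arcI orbT.
- by case/esym/jk_inv: ev xt => u' _ -> h; move: (hx u'); rewrite h.
Qed.

Definition loops4 : nat :=
  n_comp e4 [pred x | [forall y, ~~ connect e4 x (inl y)]].

Local Lemma n_comp_split (T : finType) (e : rel T) (a b : pred T) :
  n_comp e a = n_comp e [predI a & b] + n_comp e [predI a & [predC b]].
Proof.
rewrite /n_comp_mem -(cardID b); congr addn; apply: eq_card => x;
  rewrite !inE; first by rewrite andbA.
by rewrite andbC andbA.
Qed.

Lemma loops4E : loops4 = loops D1 D2 + loops (compose D1 D2) D3.
Proof.
pose touch : pred node4 := fun w => [exists i, connect e4 w (inr (inr i))].
have ct : closed e4 touch.
  apply: intro_closed; first exact: stacked4_csym.
  move=> x y xy /existsP[i h]; apply/existsP; exists i.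
  by rewrite stacked4_csym; apply: connect_trans (connect1 xy); rewrite stacked4_csym.
have ci := @closed_avoid _ _ (fun y => inl y : node4) (@stacked4_sym D1 D2 D3).
rewrite /loops4 (n_comp_split _ _ touch) addnC; congr addn.
- have cl : closed e4 [predI [pred x | [forall y, ~~ connect e4 x (inl y)]] & [predC touch]].
    move=> x y xy; move: (ci _ _ xy) (ct _ _ xy); rewrite !inE => -> h.
    by congr (_ && ~~ _).
  have pre x : (top3 x \in [predI [pred x | [forall y, ~~ connect e4 x (inl y)]] & [predC touch]])
     = [forall y, ~~ connect e3 x (inl y)].
    apply/idP/forallP; rewrite !inE.
      move=> /andP[/forallP h1 /existsPn h2] [] i; apply/negP => /c34 /= h.
        by move: (h1 (inl i)); rewrite h.
      by move: (h2 i); rewrite h.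
    move=> h; apply/andP; split.
      apply/forallP => y; apply/negP => /(inner4 h)[] [[]|] l //= [] _ hl.
      by move: (h (inl l)); rewrite hl.
    apply/existsPn => y; apply/negP => /(inner4 h)[] [[]|] l //= [] _ hl.
    by move: (h (inr l)); rewrite hl.
  rewrite (adjunction_n_comp top3 (@stacked4_csym _ _ _) (@stacked_csym D1 D2) cl).
    by apply: eq_n_comp_r => x; rewrite inE /= pre inE.
  split.
    case=> [x|[]i] /andP[].
    + by rewrite inE => /forallP/(_ x); rewrite connect0.
    + by move=> _ _; exists (inr i); apply: connect0.
    + by move=> _ /existsPn/(_ i); rewrite connect0.
  move=> x y kx; apply/idP/idP => [/c34 //|].
  have /forallP hx : [forall y, ~~ connect e3 x (inl y)] by rewrite -pre.
  by case/(inner4 hx) => t /k_inj ->.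
- have cl : closed e4 [predI [pred x | [forall y, ~~ connect e4 x (inl y)]] & touch].
    move=> x y xy; move: (ci _ _ xy) (ct _ _ xy); rewrite !inE => -> h.
    by congr (_ && _).
  rewrite (adjunction_n_comp bot3 (@stacked4_csym _ _ _)
             (@stacked_csym (compose D1 D2) D3) cl).
    apply: eq_n_comp_r => x; rewrite !inE; apply/andP/forallP.
      by case=> /forallP h _ y; rewrite -connect4 h.
    move=> h; split; first by apply/forallP => y; rewrite (connect4 x (inl y)) h.
    case: x h => [x|i] h; first by move: (h x); rewrite connect0.
    by apply/existsP; exists i; apply: connect0.
  split; last by move=> x y _; rewrite connect4.
  by move=> x /andP[_ /existsP/sigW[i h]]; exists (inr i).
Qed.

Lemma compose4 x z : connect e4 (inl x) (inl z)
  = (z == x) || (z == compose (compose D1 D2) D3 x).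
Proof. by rewrite (connect4 (inl x) (inl z)) composeP. Qed.

End Fixed.

Lemma loops4_flip D1 D2 D3 :
  loops4 (flip D3) (flip D2) (flip D1) = loops4 D1 D2 D3.
Proof.
apply: (n_comp_iso mirror4K (@stacked4_sym D1 D2 D3)); first exact: stacked4_sym.
- exact: stacked4_flip.
- move=> x /=; apply/forallP/forallP => h y; move: (h (swap y));
  have := connect_iso mirror4K (stacked4_flip D1 D2 D3) x (inl y);
  have := connect_iso mirror4K (stacked4_flip D1 D2 D3) x (inl (swap y));
  by rewrite /= swapK => E1 E2; rewrite ?E1 ?E2.
- exact/closed_avoid/stacked4_sym.
Qed.

Lemma loopsA D1 D2 D3 :
  loops D1 D2 + loops (compose D1 D2) D3 = loops D2 D3 + loops D1 (compose D2 D3).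
Proof.
by rewrite -loops4E -loops4_flip loops4E compose_flip !loops_flip.
Qed.

Lemma composeA D1 D2 D3 :
  compose D1 (compose D2 D3) = compose (compose D1 D2) D3.
Proof.
rewrite -[LHS]flip_inv -(compose_flip D1) -(compose_flip D2).
apply: diagramP => x; rewrite flipE; set y := compose _ _ _.
have yx : y != swap x by apply: partner_neq.
have : connect (stacked4 (flip D3) (flip D2) (flip D1)) (inl (swap x)) (inl y).
  by rewrite compose4 eqxx orbT.
have := connect_iso mirror4K (stacked4_flip D1 D2 D3) (inl x) (inl (swap y)).
rewrite /= swapK => ->; rewrite compose4.
by rewrite (inv_eq swapK) (negPf yx) => /eqP.
Qed.

End Assoc.

Lemma compose1 D : compose id_diagram D = D.
Proof.
have hop i : connect (stacked id_diagram D) (inl (inl i)) (inr i).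
  have := arcI above id_diagram (inl i); rewrite ffunE /= invg1 perm1 => h.
  by apply: connect1; rewrite /stacked h.
have hopb u : connect (stacked id_diagram D) (inl u) (below u).
  by case: u => i /=; rewrite ?connect0 ?hop.
apply: diagramP => x; apply: compose_uniq; first exact: partner_neq.
apply: (connect_trans (hopb x)); rewrite stacked_csym.
apply: (connect_trans (hopb _)); rewrite stacked_csym.
by apply: connect1; rewrite /stacked arcI orbT.
Qed.

Lemma loops1 D : loops id_diagram D = 0.
Proof.
have hop i : connect (stacked id_diagram D) (inl (inl i)) (inr i).
  have := arcI above id_diagram (inl i); rewrite ffunE /= invg1 perm1 => h.
  by apply: connect1; rewrite /stacked h.
apply: eq_card0 => -[x|i]; rewrite !inE /=; apply/andP => -[_ /forallP].
  by move/(_ x); rewrite connect0.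
by move/(_ (inl i)); rewrite stacked_csym hop.
Qed.

Lemma flip1 : flip id_diagram = id_diagram.
Proof. by apply: diagramP => x; rewrite !ffunE; case: x => i /=; rewrite ?invg1 !perm1. Qed.

Lemma composeD1 D : compose D id_diagram = D.
Proof. by rewrite -[LHS]flip_inv -(compose_flip D) flip1 compose1 flip_inv. Qed.

Lemma loopsD1 D : loops D id_diagram = 0.
Proof. by rewrite -loops_flip flip1 loops1. Qed.

End Diagram.

Local Open Scope ring_scope.

(* The underlying vector space has the diagrams as a basis; [delta] only enters
   the product. *)
Definition brauer (K : fieldType) (delta : K) (r : nat) : Type :=
  {ffun diagram r -> K^o}.

HB.instance Definition _ K delta r :=
  Vector.copy (@brauer K delta r) {ffun diagram r -> K^o}.

Section BrauerAlgebra.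
Variables (K : fieldType) (delta : K) (r : nat).
Local Notation B := (brauer delta r).
Implicit Types (D : diagram r) (x y z : B).

Definition of_diagram D : B := [ffun D' => (D' == D)%:R].

Definition brauer_mul x y : B :=
  \sum_D1 \sum_D2
    (x D1 * y D2 * delta ^+ loops D1 D2) *: of_diagram (compose D1 D2).

Lemma brauer_sum x : x = \sum_D (x D) *: of_diagram D.
Proof.
apply/ffunP => D; rewrite sum_ffunE (bigD1 D) //= !ffunE eqxx [_ *: _]mulr1.
rewrite big1 ?addr0 // => D' nD; rewrite !ffunE eq_sym (negPf nD).
exact: mulr0.
Qed.

Lemma brauer_mul_diagram D1 D2 :
  brauer_mul (of_diagram D1) (of_diagram D2)
    = delta ^+ loops D1 D2 *: of_diagram (compose D1 D2).
Proof.
rewrite /brauer_mul (bigD1 D1) //= [X in _ + X]big1 ?addr0 => [|D nD]; last first.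
  by apply: big1 => D' _; rewrite ffunE (negPf nD) !mul0r scale0r.
rewrite (bigD1 D2) //= big1 ?addr0 => [|D nD]; last first.
  by rewrite !ffunE (negPf nD) mulr0 mul0r scale0r.
by rewrite !ffunE !eqxx !mul1r.
Qed.

Lemma brauer_mulP a x y z : brauer_mul (a *: x + y) z
  = a *: brauer_mul x z + brauer_mul y z.
Proof.
rewrite /brauer_mul scaler_sumr -big_split; apply: eq_bigr => D1 _ /=.
rewrite scaler_sumr -big_split; apply: eq_bigr => D2 _ /=.
by rewrite scalerA -scalerDl !ffunE !mulrDl !mulrA.
Qed.

Lemma brauer_mulrP a x y z : brauer_mul z (a *: x + y)
  = a *: brauer_mul z x + brauer_mul z y.
Proof.
rewrite /brauer_mul scaler_sumr -big_split; apply: eq_bigr => D1 _ /=.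
rewrite scaler_sumr -big_split; apply: eq_bigr => D2 _ /=.
rewrite scalerA -scalerDl !ffunE mulrDr mulrDl; congr ((_ + _) *: _).
by rewrite [_ *: _]/(a * _) mulrCA !mulrA.
Qed.

Lemma brauer_mulDl : left_distributive brauer_mul +%R.
Proof. by move=> x y z; have := brauer_mulP 1 x y z; rewrite !scale1r. Qed.

Lemma brauer_mulDr : right_distributive brauer_mul +%R.
Proof. by move=> x y z; have := brauer_mulrP 1 y z x; rewrite !scale1r. Qed.

Lemma brauer_mul0 x : brauer_mul 0 x = 0.
Proof. by apply: (addrI (brauer_mul 0 x)); rewrite -brauer_mulDl !addr0. Qed.

Lemma brauer_mulr0 x : brauer_mul x 0 = 0.
Proof. by apply: (addrI (brauer_mul x 0)); rewrite -brauer_mulDr !addr0. Qed.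

Lemma brauer_scaleAl a x y : a *: brauer_mul x y = brauer_mul (a *: x) y.
Proof.
by have := brauer_mulP a x 0 y; rewrite brauer_mul0 !addr0.
Qed.

Lemma brauer_scaleAr a x y : a *: brauer_mul x y = brauer_mul x (a *: y).
Proof.
by have := brauer_mulrP a y 0 x; rewrite brauer_mulr0 !addr0.
Qed.

Lemma brauer_ind (P : B -> Prop) :
  (forall D, P (of_diagram D)) ->
  (forall a x y, P x -> P y -> P (a *: x + y)) -> P 0 -> forall x, P x.
Proof.
move=> Pd Pl P0 x; rewrite [x]brauer_sum.
by elim/big_rec: _ => // D y _ Py; apply: Pl.
Qed.

Lemma brauer_mulA : associative brauer_mul.
Proof.
move=> x y z; elim/brauer_ind: x => [D1|a x x' IH IH'|]; last first.
- by rewrite !brauer_mul0.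
- by rewrite !brauer_mulP IH IH'.
elim/brauer_ind: y => [D2|a y y' IH IH'|]; last first.
- by rewrite !(brauer_mul0, brauer_mulr0).
- by rewrite !(brauer_mulP, brauer_mulrP) IH IH'.
elim/brauer_ind: z => [D3|a z z' IH IH'|]; last first.
- by rewrite !brauer_mulr0.
- by rewrite !brauer_mulrP IH IH'.
rewrite !brauer_mul_diagram -brauer_scaleAl -brauer_scaleAr.
by rewrite !brauer_mul_diagram !scalerA -!exprD loopsA composeA.
Qed.

Lemma brauer_mul1 : left_id (of_diagram (id_diagram r)) brauer_mul.
Proof.
elim/brauer_ind => [D|a x y IH IH'|].
- by rewrite brauer_mul_diagram loops1 compose1 scale1r.
- by rewrite brauer_mulrP IH IH'.
- exact: brauer_mulr0.
Qed.

Lemma brauer_mulr1 : right_id (of_diagram (id_diagram r)) brauer_mul.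
Proof.
elim/brauer_ind => [D|a x y IH IH'|].
- by rewrite brauer_mul_diagram loopsD1 composeD1 scale1r.
- by rewrite brauer_mulP IH IH'.
- exact: brauer_mul0.
Qed.

Lemma brauer1_neq0 : of_diagram (id_diagram r) != 0.
Proof.
apply/eqP => /ffunP/(_ (id_diagram r))/eqP.
by rewrite !ffunE eqxx oner_eq0.
Qed.

HB.instance Definition _ := GRing.Zmodule_isNzRing.Build B
  brauer_mulA brauer_mul1 brauer_mulr1 brauer_mulDl brauer_mulDr brauer1_neq0.
HB.instance Definition _ := GRing.Lmodule_isLalgebra.Build K B brauer_scaleAl.
HB.instance Definition _ := GRing.Lalgebra_isAlgebra.Build K B brauer_scaleAr.
HB.instance Definition _ := Algebra_isFalgebra.Build K B.

End BrauerAlgebra.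

Arguments of_diagram {K} delta {r} D.

(* The generators are numbered from 1 as usual: s_gen i and e_gen i are
   meaningful for 1 <= i <= n only, and involve the nodes i and i + 1, which
   are the ordinals i - 1 and i. *)
Section Generators.
Variables (K : fieldType) (delta : K) (n : nat).
Local Notation B := (brauer delta n.+1).

Definition s_gen (i : nat) : B :=
  of_diagram delta (perm_diagram (tperm (inord i.-1) (inord i))).

Definition e_gen (i : nat) : B :=
  of_diagram delta (cupcap_diagram (inord i.-1) (inord i)).

Definition sym_sum : B :=
  \sum_(s : 'S_n.+1) of_diagram delta (perm_diagram s).

Definition e_prod (k : nat) : B := \prod_(1 <= j < k.+1) e_gen (n + 2 - 2 * j).

End Generators.

Arguments sym_sum {K} delta n.
Arguments e_prod {K} delta n k.

Definition Phi (K : fieldType) (n : nat) : brauer (- (2 * n)%:R : K) n.+1 :=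
  \sum_(0 <= k < (n.+1)./2.+1)
    ((2 ^ k * k`!) ^ 2 * (n.+1 - 2 * k)`!)%:R^-1
      *: (sym_sum _ n * e_prod _ n k * sym_sum _ n).

(* Matrices act on column vectors; the degree is d.+1. *)
Notation representation A d := {lrmorphism A -> 'M_d.+1}.

Section Representations.
Variables (K : fieldType) (A : falgType K).

Definition irreducible d (rho : representation A d) : Prop :=
  forall U : {vspace 'cV[K]_d.+1},
    (forall a u, u \in U -> rho a *m u \in U) -> U = 0%VS \/ U = fullv.

Definition isomorphic d1 d2
    (rho1 : representation A d1) (rho2 : representation A d2) : Prop :=
  exists2 P : 'M[K]_(d2.+1, d1.+1), row_free P && row_full P &
    forall a, P *m rho1 a = rho2 a *m P.

(* The central idempotent acting as the identity in rho and as zero in every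
   irreducible representation not isomorphic to rho. *)
Definition central_idempotent_of d (rho : representation A d) (z : A) : Prop :=
  [/\ z * z = z, forall a, z * a = a * z, rho z = 1 &
      forall d' (rho' : representation A d'),
        irreducible rho' -> ~ isomorphic rho rho' -> rho' z = 0].

(* The span of the products x * z * y. *)
Definition generated_ideal (z : A) : {vspace A} :=
  (fullv * <[z]> * fullv)%VS.

End Representations.

Definition trivial_representation (K : fieldType) (delta : K) (n : nat)
    (rho : representation (brauer delta n.+1) 0) : Prop :=
  forall i, (1 <= i <= n)%N ->
    rho (s_gen delta n i) = 1 /\ rho (e_gen delta n i) = 0.

(* Main.v *)
Require Import Defs.
From HB Require Import structures.
From mathcomp Require Import all_boot fingroup perm all_algebra falgebra.
From mathcomp Require Import zify.

Set Implicit Arguments.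
Unset Strict Implicit.
Unset Printing Implicit Defensive.

Import GRing.Theory.
Local Open Scope ring_scope.

(** The theorem rests on one identity: [Phi] is the sum of all diagrams, each
    with coefficient 1. Given this, put T for that sum and r = n + 1.

    Left and right multiplication by a permutation only relabels diagrams, so
    it fixes T. For a <> b let e be the diagram with an arc a - b in both rows
    and vertical arcs elsewhere ([cupcap_diagram a b]). If D joins the upper
    nodes a and b, then e D = delta D. Otherwise e D is obtained from D without
    a loop: a and b become joined, and so do their former partners. A diagram
    D' with an upper arc a - b comes from 2 (r - 1) = 2 n diagrams of the
    second kind, one for each node other than a and b (the former partner of
    a). Hence e T is (delta + 2 n) times the sum of the diagrams with an upper
    arc a - b, which is 0 for delta = - 2 n ([recouple_diagram_sum]). A diagram
    D that is not a permutation has an arc in its lower row, so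
    D = delta^-1 D e for a suitable e, and D T = 0; the same holds on the other
    side. So D T = T D = rho(D) T for every diagram, where rho(D) is 1 on
    permutations and 0 on the other diagrams, and rho(T) = r!.

    That [Phi] = T is an orbit count. The group Sym_r x Sym_r acts on diagrams
    by relabelling the two rows, and the orbits are the classes N(k) of the
    diagrams with k arcs in each row ([same_orbitP]). So every element of N(k)
    occurs equally often in Sigma E(k) Sigma, namely (r!)^2 / #N(k) times. This
    number is (2^k k!)^2 (r - 2k)!, because #N(k+1) (2k+2)^2 =
    #N(k) (r - 2k) (r - 2k - 1): exchanging an upper and a lower arc, both
    oriented, for two vertical arcs is a bijection ([card_with_cupsS]).

    Both counts use the same operation [recouple D x z], which joins x to z and
    the old partner of x to the old partner of z; remembering the old partner
    of x makes it reversible ([recouple_big]).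

    Finally, let z satisfy a z = z a = rho(a) z and rho(z) = 1. If z acts as a
    nonzero matrix in an irreducible representation, any nonzero column of that
    matrix spans an invariant line on which the algebra acts through rho, so
    the representation is isomorphic to rho. This makes z the idempotent of
    rho. It is the only one, since another such idempotent y satisfies
    y z = z y = z, so that y - z is an idempotent killed by all irreducible
    representations, and such an idempotent vanishes
    ([idempotent_irreducible_eq0]). *)

(** * Idempotents killed by all irreducible representations *)

Section LeftIdeals.
Import VectorInternalTheory.
Variables (K : fieldType) (A : falgType K).

Local Notation N := (dim A).
Definition lmul_mx (a : A) : 'M[K]_N := lin1_mx (v2r \o amull a \o r2v).

Lemma mul_lmul_mx u a : u *m lmul_mx a = v2r (a * r2v u).
Proof. by rewrite mul_rV_lin1 /= lfunE. Qed.

(** Row-vector coordinates on the quotient by a subspace: [Q] is the projection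
    and [P] a section of it. *)
Lemma quotient_coordinates (M : {vspace A}) : exists m (P : 'M[K]_(m, N)) Q,
  P *m Q = 1%:M /\ forall x, (v2r x *m Q == 0) = (x \in M).
Proof.
pose C := cokermx (vs2mx M); exists (\rank C)%MS, (pinvmx (col_base C)),
  (col_base C).
split; first by rewrite mulVpmx ?col_base_full.
move=> x; rewrite memvE /subsetv /= genmxE submxE -/C -[in RHS](mulmx_base C)
  mulmxA.
by rewrite mulmx_free_eq0 // row_base_free.
Qed.

(** The representation on the quotient of the regular module by a proper left
    ideal, with its projection [p] and a section [s]. *)
Lemma quotient_representation (M : {vspace A}) :
  (forall a x, x \in M -> a * x \in M) -> M != fullv ->
  exists d (rho : representation A d) (p : {linear A -> 'cV[K]_d.+1})
    (s : 'cV[K]_d.+1 -> A),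
  [/\ cancel s p, forall x, (p x == 0) = (x \in M)
    & forall a x, p (a * x) = rho a *m p x].
Proof.
move=> idM nM; have [[|d] [P [Q [PQ kQ]]]] := quotient_coordinates M.
  case/eqP: nM; apply/vspaceP => x; rewrite memvf -kQ.
  by apply/eqP/matrixP => i [].
(* Transposed, because representations act on columns. *)
pose p : {linear A -> 'cV[K]_d.+1} := trmx \o mulmxr Q \o (v2r : A -> _).
pose s (v : 'cV[K]_d.+1) : A := r2v (v^T *m P).
pose f a := (P *m lmul_mx a *m Q)^T.
have sK : cancel s p.
  move=> v; rewrite /p /s /= r2vK -mulmxA PQ mulmx1; exact: trmxK.
have kp x : (p x == 0) = (x \in M).
  by rewrite -kQ /p /= -[X in _ == X]trmx0 (inj_eq trmx_inj).
have fp a x : p (a * x) = f a *m p x.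
  have: p (a * (x - s (p x))) == 0 by rewrite kp idM // -kp linearB sK subrr.
  rewrite mulrBr linearB subr_eq0 => /eqP->.
  by rewrite /p /f /s /= -trmx_mul !mulmxA mul_lmul_mx !trmxK.
have fE a v : f a *m v = p (a * s v) by rewrite fp sK.
have ext (B C : 'M[K]_d.+1) : (forall v : 'cV_d.+1, B *m v = C *m v) -> B = C.
  move=> BC; apply/trmx_inj/row_matrixP => i.
  by rewrite !rowE; apply/trmx_inj; rewrite !trmx_mul !trmxK BC.
have fl : linear f.
  move=> c a b; apply: ext => v; rewrite mulmxDl -scalemxAl !fE.
  by rewrite mulrDl -scalerAl linearP.
have fm : monoid_morphism f.
  split=> [|a b]; apply: ext => v; first by rewrite fE mul1r sK mul1mx.
  by rewrite -mulmxA !fE -mulrA fp fE.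
pose rho : representation A d := HB.pack f (GRing.isLinear.Build _ _ _ _ f fl)
  (GRing.isMonoidMorphism.Build _ _ f fm).
by exists d, rho, p, s.
Qed.

(** A proper such M of maximal dimension would have an irreducible quotient;
    [w] would act on it as 0, so that M would contain [w] and 1 = (1 - w) + w.
    Descending on the codimension of M gives this without choosing a maximal
    ideal: a proper nonzero invariant subspace of the quotient pulls back to a
    larger left ideal, to which the induction hypothesis applies. *)
Lemma left_ideal_full (w : A) :
  (forall d (rho : representation A d), irreducible rho -> rho w = 0) ->
  forall M : {vspace A},
    (forall a x, x \in M -> a * x \in M) -> 1 - w \in M -> M = fullv.
Proof.
move=> w0 M; have [m] := ubnP (\dim {:A} - \dim M).
elim: m M => // m IH M ltm idM wM.
apply/eqP; apply: contraT => nM.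
have [d [rho [p [s [sK kp pM]]]]] := quotient_representation idM nM.
have irr : irreducible rho.
  move=> U stU; have [->|nU] := eqVneq U 0%VS; [by left | right].
  pose M' := (linfun p @^-1: U)%VS.
  have inM' x : (x \in M') = (p x \in U) by rewrite -memv_preim lfunE.
  have MM' : (M <= M')%VS.
    by apply/subvP => x; rewrite inM' -kp => /eqP->; apply: mem0v.
  have M'f : M' = fullv.
    apply: IH => [|a x|]; last exact: (subvP MM').
    - have ltMM' : (\dim M < \dim M')%N.
        rewrite ltnNge; apply: contra nU => le.
        have /eqP eqMM' : M == M' by rewrite eqEdim MM' le.
        apply/eqP/vspaceP => v; rewrite memv0 -{1}(sK v) -inM' -eqMM'.
        by rewrite -kp sK.
      have := dimvS (subvf M'); lia.
    - by rewrite !inM' pM; apply: stU.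
  by apply/vspaceP => v; rewrite memvf -(sK v) -inM' M'f memvf.
case/eqP: nM; apply/vspaceP => x; rewrite memvf -[x]mulr1; apply: idM.
rewrite -[1](subrK w) memvD // -kp -[w]mulr1 pM w0 //.
by rewrite mul0mx.
Qed.

(** The left ideal A (1 - w) is everything by the previous lemma, and it is
    annihilated by right multiplication by [w]. *)
Lemma idempotent_irreducible_eq0 (w : A) : w * w = w ->
  (forall d (rho : representation A d), irreducible rho -> rho w = 0) -> w = 0.
Proof.
move=> ww w0; pose M := (fullv * <[1 - w]>)%VS.
have : w \in M.
  rewrite (left_ideal_full w0 (M := M)) ?memvf // => [a x|].
    by move=> /(memv_mul (memvf a)); rewrite prodvA; apply: subvP;
      rewrite prodvSl ?subvf.
  by rewrite -[1 - w]mul1r memv_mul ?memvf ?memv_line.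
case/memv_cosetP=> a _ wE.
by rewrite -ww {1}wE -mulrA mulrBl mul1r ww subrr mulr0.
Qed.

End LeftIdeals.

(** * Eigenvectors of a one-dimensional representation *)

Section OneDimensional.
Variables (K : fieldType) (A : falgType K) (rho : representation A 0) (z : A).
Hypotheses (zE : forall a, a * z = rho a 0 0 *: z).
Hypotheses (zEr : forall a, z * a = rho a 0 0 *: z).
Hypothesis rho_z : rho z = 1.

Lemma isomorphic_eq0 d (rho' : representation A d) a :
  isomorphic rho rho' -> rho a = 0 -> rho' a = 0.
Proof.
case=> P /andP[/row_freeP[Q PQ] _] PE ra.
by rewrite -[rho' a]mulmx1 -PQ mulmxA -PE ra mulmx0 mul0mx.
Qed.

(** A nonzero column of the matrix of [z] spans an invariant line, on which the
    algebra acts through [rho]; by irreducibility it is the whole space. *)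
Lemma irreducible_isomorphic d (rho' : representation A d) :
  irreducible rho' -> rho' z != 0 -> isomorphic rho rho'.
Proof.
move=> irr /matrix0Pn[i [j nij]].
have [v vE nv] : exists2 v : 'cV_d.+1,
    forall a, rho' a *m v = rho a 0 0 *: v & v != 0.
  exists (col j (rho' z)) => [a|].
    have rz : rho' a *m rho' z = rho a 0 0 *: rho' z.
      by rewrite -linearZ -zE rmorphM.
    by rewrite colE mulmxA rz -scalemxAl.
  by apply/matrix0Pn; exists i, 0; rewrite mxE.
have /irr[/eqP|] : forall a u, u \in <[v]>%VS -> rho' a *m u \in <[v]>%VS.
- by move=> a _ /vlineP[c ->]; rewrite -scalemxAr vE !memvZ ?memv_line.
- by rewrite -dimv_eq0 dim_vline nv.
move=> /(congr1 (fun U => \dim U)); rewrite dim_vline nv dimvf /dim /= muln1.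
case=> /esym d0; subst d; exists v.
  by rewrite /row_free /row_full rank_rV nv.
by move=> a; rewrite vE {1}[rho a]mx11_scalar mul_mx_scalar.
Qed.

Lemma eigenvector_central_idempotent : central_idempotent_of rho z.
Proof.
split=> // [|a|d rho' irr niso]; rewrite ?zE ?zEr ?rho_z ?mxE ?scale1r //.
by apply/eqP; apply: contra_notT niso; apply: irreducible_isomorphic.
Qed.

Lemma eigenvector_central_idempotent_unique :
  unique (central_idempotent_of rho) z.
Proof.
split; first exact: eigenvector_central_idempotent.
move=> y [yy yC rho_y y0].
have zy : z * y = z by rewrite zEr rho_y mxE scale1r.
have yz : y * z = z by rewrite yC.
have zz : z * z = z by rewrite zE rho_z mxE scale1r.
apply/esym/eqP; rewrite -subr_eq0; apply/eqP; apply: idempotent_irreducible_eq0.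
  by rewrite mulrBr !mulrBl yy zy yz zz subrr subr0.
move=> d rho' irr; have r0 : rho (y - z)
  = 0 by rewrite raddfB /= rho_y rho_z subrr.
apply/eqP; apply: contraT => nz.
have niso : ~ isomorphic rho rho'.
  by move=> iso; rewrite (isomorphic_eq0 iso r0) eqxx in nz.
rewrite raddfB /= y0 // sub0r oppr_eq0 in nz.
by case: niso; apply: irreducible_isomorphic.
Qed.

Lemma dim_generated_ideal : \dim (generated_ideal z) = 1%N.
Proof.
have z0 : z != 0 by apply: contra_eq_neq rho_z => ->;
  rewrite raddf0 eq_sym oner_eq0.
suff -> : generated_ideal z = <[z]>%VS by rewrite dim_vline z0.
apply/eqP; rewrite eqEsubv; apply/andP; split; last first.
  by rewrite -memvE -[X in X \in _]mul1r -[X in X \in _]mulr1 !memv_mul ?memvf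
    ?memv_line.
have zf : (<[z]> * fullv <= <[z]>)%VS.
  by apply/prodvP => _ b /vlineP[c ->] _;
    rewrite -scalerAl zEr !memvZ ?memv_line.
rewrite /generated_ideal -prodvA; apply/prodvP =>
  a x _ /(subvP zf)/vlineP[c ->].
by rewrite -scalerAr zE !memvZ ?memv_line.
Qed.

End OneDimensional.

(** * Relabelling and recoupling diagrams *)

Section Relabel.
Variable r : nat.
Implicit Types (D : diagram r) (p : {perm node r}) (x y z : node r).

Lemma relabel_neq p D x : p (D (p^-1%g x)) != x.
Proof. by rewrite -{2}[x](permKV p) (inj_eq perm_inj) partner_neq. Qed.

Lemma relabel_involutive p D : involutive (fun x => p (D (p^-1%g x))).
Proof. by move=> x; rewrite permK partnerK permKV. Qed.

Definition relabel p D : diagram r :=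
  Diagram (matching_ffun (relabel_neq p D) (@relabel_involutive p D)).

Lemma relabelE p D x : relabel p D (p x) = p (D x).
Proof. by rewrite ffunE permK. Qed.

Lemma relabel_fixed p D x : p x = x -> relabel p D x = p (D x).
Proof. by move=> px; rewrite -{1}px relabelE. Qed.

Lemma relabelM p q D : relabel p (relabel q D) = relabel (q * p)%g D.
Proof. by apply: diagramP => x; rewrite !ffunE invMg !permM. Qed.

Lemma relabel1 D : relabel 1%g D = D.
Proof. by apply: diagramP => x; rewrite !ffunE invg1 !perm1. Qed.

Lemma relabelK p : cancel (relabel p) (relabel p^-1%g).
Proof. by move=> D; rewrite relabelM mulgV relabel1. Qed.

Definition rows_fun (s t : 'S_r) x : node r :=
  match x with inl i => inl (s i) | inr i => inr (t i) end.

Lemma rows_fun_inj s t : injective (rows_fun s t).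
Proof. by case=> i [] j //= [/perm_inj->]. Qed.

Definition rows_perm s t : {perm node r} := perm (@rows_fun_inj s t).

Lemma rows_perml s t i : rows_perm s t (inl i) = inl (s i).
Proof. by rewrite permE. Qed.

Lemma rows_permr s t i : rows_perm s t (inr i) = inr (t i).
Proof. by rewrite permE. Qed.

Lemma rows_permM s t s' t' :
  (rows_perm s t * rows_perm s' t')%g = rows_perm (s * s')%g (t * t')%g.
Proof. by apply/permP => -[] i; rewrite permM !(rows_perml,
  rows_permr) permM. Qed.

(** Encoded as conjugation by a transposition: this joins [x] to [z] and the
    partners of [x] and [z] to each other, and the relabelling lemmas apply to
    it.  For z = D x it is the identity. *)
Definition recouple D x z : diagram r := relabel (tperm z (D x)) D.

Lemma recouplel D x z : z != x -> recouple D x z x = z.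
Proof.
by move=> zx; rewrite relabel_fixed ?tpermR // tpermD // partner_neq.
Qed.

Lemma recoupleK D x z : z != x -> recouple (recouple D x z) x (D x) = D.
Proof.
move=> zx; rewrite {1}/recouple recouplel // /recouple relabelM tpermC.
by rewrite tperm2 relabel1.
Qed.

Lemma recouple_partner D x : recouple D x (D x) = D.
Proof. by rewrite /recouple tperm1 relabel1. Qed.

Lemma recoupler D x z : z != x -> recouple D x z (D x) = D z.
Proof.
move=> zx; rewrite -[X in _ X = _](tpermL z (D x)) relabelE.
have [->|zDx] := eqVneq z (D x); first by rewrite tperm1 perm1.
by rewrite tpermD // 1?eq_sym ?partner_neq // (inj_eq
  (inv_inj (@partnerK _ D))).
Qed.

Lemma recouple_other D x z w : w \notin [:: x; z; D x; D z] ->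
  recouple D x z w = D w.
Proof.
rewrite !inE !negb_or => /and4P[wx wz wDx wDz].
rewrite relabel_fixed tpermD // eq_sym //.
  by rewrite (inv_eq (@partnerK _ D)).
by rewrite (inj_eq (inv_inj (@partnerK _ D))).
Qed.

(** The map (D, z) |-> (recouple D x z, D x) is an involution of the pairs with
    z <> x; this is the bijection behind all counting arguments below. *)
Lemma recouple_big (V : Type) (idx : V) (op : Monoid.com_law idx) x
    (P : diagram r -> node r -> bool) (F : diagram r -> node r -> V) :
  \big[op/idx]_(q : diagram r * node r | (q.2 != x) && P q.1 q.2) F q.1 q.2 =
  \big[op/idx]_(q : diagram r * node r | (q.2 != x) && P (recouple q.1 x q.2)
    (q.1 x))
    F (recouple q.1 x q.2) (q.1 x).
Proof.
pose h (q : diagram r * node r) := (recouple q.1 x q.2, q.1 x).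
rewrite (reindex_onto h h) => [|[D z] /= /andP[zx _]] /=.
  apply: eq_bigl => -[D z] /=; rewrite partner_neq /=.
  have [->|zx] /= := eqVneq z x; last by rewrite /h /= recoupleK // recouplel
    // eqxx andbT.
  by apply/negP => /andP[_ /eqP/(congr1 snd)/eqP];
    rewrite (negPf (partner_neq _ _)).
by rewrite /h /= recoupleK // recouplel.
Qed.

End Relabel.

(** * Products with permutations and with the diagrams e *)

Section Products.
Variable r : nat.
Implicit Types (D : diagram r) (x y z : node r).

Lemma loops_eq0 D1 D2 :
  (forall i, exists x, connect (stacked D1 D2) (inr i) (inl x)) ->
    loops D1 D2 = 0%N.
Proof.
move=> h; apply: eq_card0 => -[x|i]; rewrite !inE /=;
  apply/andP => -[_ /forallP a].
  by have := a x; rewrite connect0.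
by have [x] := h i; apply/negP.
Qed.

Lemma connect_above D1 D2 x :
  connect (stacked D1 D2) (above x) (above (D1 x)).
Proof. by apply: connect1; rewrite /stacked arcI. Qed.

Lemma connect_below D1 D2 x :
  connect (stacked D1 D2) (below x) (below (D2 x)).
Proof. by apply: connect1; rewrite /stacked arcI orbT. Qed.

Section PermLeft.
Variables (s : 'S_r) (D : diagram r).

(** Through a permutation placed on top, the upper row is connected to the
    middle row by a bijection. *)
Lemma connect_perm x :
  connect (stacked (perm_diagram s) D) (inl (rows_perm s 1%g x)) (below x).
Proof.
case: x => i; last by rewrite rows_permr perm1 connect0.
have := connect_above (perm_diagram s) D (inl (s i)).
by rewrite rows_perml ffunE /= permK.
Qed.

Lemma compose_perm :
  compose (perm_diagram s) D = relabel (rows_perm s 1%g) D.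
Proof.
apply: diagramP => x; apply: compose_uniq; first exact: partner_neq.
rewrite -[x](permKV (rows_perm s 1%g)) relabelE.
apply: connect_trans (connect_perm _) _.
apply: connect_trans (connect_below _ _ _) _.
by rewrite stacked_csym; apply: connect_perm.
Qed.

Lemma loops_perm : loops (perm_diagram s) D = 0%N.
Proof.
apply: loops_eq0 => i; exists (inl (s i)); rewrite stacked_csym.
by have := connect_perm (inl i); rewrite rows_perml.
Qed.

End PermLeft.

Section CupcapLeft.
Variables (a b : 'I_r) (D : diagram r).
Hypothesis nab : a != b.
Let e := cupcap_diagram a b.
Local Notation linked := (connect (stacked e D)).

Lemma cupcapl : e (inl a) = inl b.
Proof. by rewrite ffunE /= tpermL eq_sym (negPf nab). Qed.

Lemma cupcapr : e (inr a) = inr b.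
Proof. by rewrite ffunE /= tpermL eq_sym (negPf nab). Qed.

Lemma cupcap_vertical i : i != a -> i != b -> e (inl i) = inr i.
Proof. by move=> ia ib; rewrite ffunE /= tpermD 1?eq_sym // eqxx. Qed.

Lemma linked_mid : linked (inr a) (inr b).
Proof. by have := connect_above e D (inr a); rewrite cupcapr. Qed.

Lemma linked_top : linked (inl (inl a)) (inl (inl b)).
Proof. by have := connect_above e D (inl a); rewrite cupcapl. Qed.

Lemma linked_below x : x \notin [:: inl a; inl b] -> linked (inl x) (below x).
Proof.
case: x => i; last by rewrite connect0.
rewrite !inE negb_or => /andP[ia ib].
by have := connect_above e D (inl i); rewrite cupcap_vertical.
Qed.

(** The nodes a and b of the middle row are joined by the lower arc of e, which
    links the partners of a and b in D; the arc a - b on top is the new one.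
    All other upper nodes run straight down to the middle row. *)
Lemma compose_cupcap : compose e D = recouple D (inl a) (inl b).
Proof.
have nba : inl b != inl a :> node r by rewrite eq_sym.
apply: diagramP => x; apply: compose_uniq; first exact: partner_neq.
have inv := inv_eq (@partnerK _ D).
have [->|xa] := eqVneq x (inl a); first by rewrite recouplel // linked_top.
have [->|xb] := eqVneq x (inl b).
  rewrite (_ : recouple _ _ _ _ = inl a) 1?stacked_csym ?linked_top //.
  by apply: (inv_inj (@partnerK _ (recouple D (inl a) (inl b))));
    rewrite partnerK recouplel.
have linkedx : linked (inl x) (below x) by rewrite linked_below // !inE negb_or
  xa.
have [xDa|xDa] := eqVneq x (D (inl a)).
  rewrite xDa recoupler // -xDa; apply: connect_trans linkedx _.
  apply: connect_trans (connect_below _ _ _) _; rewrite xDa partnerK /=.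
  apply: connect_trans linked_mid _; apply: connect_trans
    (connect_below e D (inl b)) _.
  rewrite stacked_csym linked_below // !inE negb_or partner_neq andbT.
  by apply: contra xb => /eqP h; rewrite xDa -h partnerK.
have [xDb|xDb] := eqVneq x (D (inl b)).
  have -> : recouple D (inl a) (inl b) x = D (inl a).
    by apply: (inv_inj (@partnerK _ (recouple D (inl a) (inl b))));
      rewrite partnerK recoupler.
  apply: connect_trans linkedx _.
  apply: connect_trans (connect_below _ _ _) _; rewrite xDb partnerK /=.
  rewrite stacked_csym; apply: connect_trans _ linked_mid.
  have := connect_below e D (inl a); rewrite stacked_csym; apply: connect_trans.
  rewrite linked_below // !inE negb_or partner_neq /=.
  by apply: contra xa => /eqP h; rewrite xDb -h partnerK.
rewrite recouple_other ?inE ?negb_or ?xa ?xb ?xDa ?xDb //.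
apply: connect_trans linkedx _; apply: connect_trans (connect_below _ _ _) _.
by rewrite stacked_csym linked_below // !inE !inv negb_or xDa xDb.
Qed.

(** Only the arc a - b in the middle row can close up, and it does exactly when
    D supplies the same arc from below. *)
Lemma loops_cupcap : loops e D = (D (inl a) == inl b).
Proof.
have [Dab|Dab] := eqVneq (D (inl a)) (inl b); last first.
  (* Without the arc a - b in D, every node of the middle row leads outside. *)
  have la : linked (inr a) (inl (D (inl a))).
    apply: connect_trans (connect_below e D (inl a)) _.
    by rewrite stacked_csym linked_below // !inE negb_or partner_neq.
  apply: loops_eq0 => i; have [->|ia] := eqVneq i a;
    first by exists (D (inl a)).
  have [->|ib] := eqVneq i b.
    by exists (D (inl a)); apply: connect_trans la;
      rewrite stacked_csym linked_mid.
  by exists (inl i); rewrite stacked_csym (@linked_below (inl i)) // !inE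
    negb_or ia.
(* The two middle nodes a and b form a component on their own, the only loop. *)
have cl : closed (stacked e D) (pred2 (inr a : node3 r) (inr b)).
  apply: intro_closed; first exact: stacked_csym.
  move=> x y /orP[]/existsP[u /andP[/eqP-> /eqP->]].
    case: u => [i|i]; rewrite !inE //= => /orP[]/eqP[->].
      by rewrite cupcapr eqxx orbT.
    by rewrite ffunE /= tpermR (negPf nab) eqxx.
  case: u => [i|i]; rewrite !inE //= => /orP[]/eqP[->].
    by rewrite Dab eqxx orbT.
  by rewrite -Dab partnerK eqxx.
apply: etrans (n_comp_connect (@stacked_csym _ e D) (inr a)).
apply: eq_n_comp_r => x; rewrite !inE; apply/forallP/idP => [|ax y].
  case: x => [x|i] h; first by have := h x; rewrite connect0.
  have [->|ia] := eqVneq i a; first exact: connect0.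
  have [->|ib] := eqVneq i b; first exact: linked_mid.
  have := h (inl i); rewrite stacked_csym (@linked_below (inl i)) //.
  by rewrite !inE negb_or ia.
apply/negP => /(connect_trans ax)/(closed_connect cl).
by rewrite !inE eqxx.
Qed.

End CupcapLeft.
End Products.

(** * Products from the right, by reflection *)

Section Flip.
Variable r : nat.
Implicit Types (D : diagram r) (x y z : node r).

Definition swap_perm : {perm node r} := perm (inv_inj (@swapK r)).

(** Reflection is itself a relabelling, so its interaction with [relabel] and
    [recouple] reduces to conjugation of permutations. *)
Lemma flip_relabel D : flip D = relabel swap_perm D.
Proof.
apply: diagramP => x; rewrite flipE -{2}[x](@swapK r).
by rewrite -[swap (swap x)](permE (inv_inj (@swapK r))) relabelE permE.
Qed.

Lemma relabel_flip p D : flip (relabel p D)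
  = relabel (p ^ swap_perm)%g (flip D).
Proof. by rewrite !flip_relabel !relabelM conjgE mulKVg. Qed.

Lemma rows_perm_swap s t : (rows_perm s t ^ swap_perm)%g = rows_perm t s.
Proof.
apply/permP => x; rewrite -[x](@swapK r) -[swap (swap x)](permE
  (inv_inj (@swapK r))).
by rewrite permJ !permE /=; case: x => i /=.
Qed.

Lemma recouple_flip D x z :
  flip (recouple D x z) = recouple (flip D) (swap x) (swap z).
Proof. by rewrite relabel_flip tpermJ !permE /recouple flipE swapK. Qed.

Lemma flip_perm_diagram (s : 'S_r) : flip (perm_diagram s)
  = perm_diagram s^-1%g.
Proof. by apply: diagramP => -[] i; rewrite flipE !ffunE //= invgK. Qed.

Lemma flip_cupcap (a b : 'I_r) : flip (cupcap_diagram a b) = cupcap_diagram a b.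
Proof. by apply: diagramP => -[] i; rewrite flipE !ffunE /=; case: ifP. Qed.

Lemma flip_composeE D1 D2 : compose D1 D2 = flip (compose (flip D2) (flip D1)).
Proof. by rewrite -compose_flip !flip_inv. Qed.

Lemma compose_permr s D :
  compose D (perm_diagram s) = relabel (rows_perm 1%g s^-1%g) D.
Proof.
by rewrite flip_composeE flip_perm_diagram compose_perm relabel_flip flip_inv
  rows_perm_swap.
Qed.

Lemma loops_permr s D : loops D (perm_diagram s) = 0%N.
Proof. by rewrite -loops_flip flip_perm_diagram loops_perm. Qed.

Lemma compose_cupcapr a b D : a != b ->
  compose D (cupcap_diagram a b) = recouple D (inr a) (inr b).
Proof.
by move=> ab; rewrite flip_composeE flip_cupcap compose_cupcap // recouple_flip
  flip_inv.
Qed.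

Lemma loops_cupcapr a b D : a != b ->
  loops D (cupcap_diagram a b) = (D (inr a) == inr b).
Proof.
by move=> ab; rewrite -loops_flip flip_cupcap loops_cupcap // flipE
  (inv_eq (@swapK r)).
Qed.

End Flip.

(** * Horizontal arcs *)

Section Cups.
Variable r : nat.
Implicit Types (D : diagram r) (x y z : node r).

Definition is_upper x := if x is inl _ then true else false.
Definition position x : 'I_r := match x with inl i => i | inr i => i end.

Lemma upperE x : is_upper x -> x = inl (position x). Proof. by case: x. Qed.
Lemma lowerE x : ~~ is_upper x -> x = inr (position x). Proof. by case: x. Qed.

Definition cups D := [set i | is_upper (D (inl i))].
Definition caps D := [set i | ~~ is_upper (D (inr i))].

Lemma cups_flip D : cups (flip D) = caps D.
Proof. by apply/setP => i; rewrite !inE flipE /=; case: (D _). Qed.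

Lemma caps_flip D : caps (flip D) = cups D.
Proof. by rewrite -cups_flip flip_inv. Qed.

(** The vertical arcs pair off the remaining nodes of the two rows. *)
Lemma card_cups D : #|cups D| = #|caps D|.
Proof.
have leC D' : (#|~: cups D'| <= #|~: caps D'|)%N.
  have pD i : i \in ~: cups D' -> D' (inl i) = inr (position (D' (inl i))).
    by rewrite !inE => /lowerE.
  rewrite -(@card_in_imset _ _ (fun i => position (D' (inl i)))) =>
    [|i j /pD iP /pD jP e].
    apply/subset_leq_card/subsetP => _ /imsetP[i /pD iP ->].
    by rewrite !inE negbK -iP partnerK.
  by apply: (@inl_inj _ 'I_r); apply: (inv_inj (@partnerK _ D'));
    rewrite iP jP e.
have := leC D; have := leC (flip D); rewrite cups_flip caps_flip.
by have := cardsC (cups D); have := cardsC (caps D); lia.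
Qed.

Lemma cups_recouple D a b c d : D (inl a) = inl b -> D (inr c) = inr d ->
  #|cups D| = (#|cups (recouple D (inl a) (inr c))|).+2.
Proof.
move=> Da Dc; have ab : a != b by have := partner_neq D (inl a);
  rewrite Da eq_sym.
have Db : D (inl b) = inl a by rewrite -Da partnerK.
rewrite (cardsD1 a) (cardsD1 b) !inE Da Db eq_sym ab /= add1n add1n;
  do 2!congr _.+1.
apply: eq_card => i; rewrite !inE.
have [->|ib] := eqVneq i b.
  by rewrite -Da recoupler // Dc.
have [->|ia] := eqVneq i a; first by rewrite recouplel.
by rewrite recouple_other // !inE !negb_or Da Dc ia ib.
Qed.

Lemma cups_recouple_vertical D a b c d : a != b ->
  D (inl a) = inr c -> D (inl b) = inr d ->
  #|cups (recouple D (inl a) (inl b))| = (#|cups D|).+2.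
Proof.
move=> ab Da Db; have ba : inl b != inl a :> node r by rewrite eq_sym.
rewrite (@cups_recouple _ a b c d) ?recouplel //;
  first by rewrite -Da recoupleK.
by rewrite -Da recoupler.
Qed.

Lemma cups_caps_neq0 D a : a \in cups D -> exists c, c \in caps D.
Proof.
by move=> aD; apply/set0Pn; rewrite -card_gt0 -card_cups card_gt0;
  apply/set0Pn; exists a.
Qed.

(** Exchange an upper and a lower arc for two vertical ones until no horizontal
    arc is left. *)
Lemma even_cups D : ~~ odd #|cups D|.
Proof.
have [m] := ubnP #|cups D|; elim: m D => // m IH D.
have [->|/set0Pn[a aD]] := eqVneq (cups D) set0; first by rewrite cards0.
have [c cD] := cups_caps_neq0 aD; move: aD cD; rewrite !inE =>
  /upperE Da /lowerE Dc.
by rewrite (cups_recouple Da Dc) /= negbK => lt; apply: IH; apply: ltnW;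
  rewrite -ltnS.
Qed.

Lemma cups_perm s : cups (perm_diagram s) = set0.
Proof. by apply/setP => i; rewrite !inE ffunE. Qed.

Lemma cups_eq0 D : cups D = set0 -> exists s, D = perm_diagram s.
Proof.
move=> c0; have Dr i : D (inr i) = inl (position (D (inr i))).
  have /eqP : caps D == set0 by rewrite -cards_eq0 -card_cups c0 cards0.
  by move/setP/(_ i); rewrite !inE => /negbFE/upperE.
have inj : injective (fun i => position (D (inr i))).
  move=> i j e; apply: (@inr_inj 'I_r); apply: (inv_inj (@partnerK _ D)).
  by rewrite Dr e -Dr.
exists (perm inj); apply: diagramP => -[] i; rewrite ffunE /=;
  last by rewrite permE.
have {1}-> : i = perm inj ((perm inj)^-1%g i) by rewrite permKV.
by rewrite [X in inl X]permE -Dr partnerK.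
Qed.

Lemma perm_diagram_inj : injective (@perm_diagram r).
Proof.
move=> s t st; apply/permP => i; have := congr1 (fun D : diagram r =>
  D (inr i)) st.
by rewrite !ffunE => -[].
Qed.

Lemma cups_relabel s t D : #|cups (relabel (rows_perm s t) D)| = #|cups D|.
Proof.
rewrite -(card_imset (cups D) (@perm_inj _ s)); apply: eq_card => i.
rewrite -[i](permKV s) (mem_imset _ _ (@perm_inj _ s)) inE.
rewrite -(rows_perml s t) relabelE.
by rewrite inE; case: (D _) => j; rewrite ?rows_perml ?rows_permr.
Qed.

End Cups.

(** * Diagrams with equally many horizontal arcs form one orbit *)

Section Transitivity.
Variable r : nat.
Implicit Types (D : diagram r) (x y z : node r).

Definition same_orbit D D' := exists st : 'S_r * 'S_r,
  relabel (rows_perm st.1 st.2) D = D'.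

Lemma same_orbit_refl D : same_orbit D D.
Proof.
exists (1%g, 1%g); rewrite (_ : rows_perm _ _ = 1%g) ?relabel1 //.
by apply/permP => -[] i; rewrite ?rows_perml ?rows_permr !perm1.
Qed.

Lemma same_orbit_trans D1 D2 D3 :
  same_orbit D1 D2 -> same_orbit D2 D3 -> same_orbit D1 D3.
Proof.
move=> [st <-] [st' <-]; exists (st.1 * st'.1, st.2 * st'.2)%g.
by rewrite relabelM rows_permM.
Qed.

Lemma same_orbit_tperm D x y : is_upper x = is_upper y ->
  same_orbit D (relabel (tperm x y) D).
Proof.
case: x y => i [] j // _; [exists (tperm i j, 1%g) | exists (1%g, tperm i j)];
  congr relabel; apply/permP => -[] k; rewrite ?rows_perml ?rows_permr ?perm1
    /=;
  rewrite ?(inj_tperm _ _ _ inl_inj) ?(inj_tperm _ _ _ inr_inj) //;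
  by rewrite tpermD.
Qed.

(** The measure on which the proof of transitivity descends: relabellings of D
    are chosen to shrink it until D becomes D'. *)
Definition mismatch D D' := [set x | D x != D' x].

Lemma mismatch_partner D D' x : (D x \in mismatch D D') = (x \in mismatch D D').
Proof.
rewrite !inE partnerK; congr negb; apply/eqP/eqP => [e|->];
  last by rewrite partnerK.
by rewrite {2}e partnerK.
Qed.

Lemma mismatch_partner' D D' x : (D' x \in mismatch D D')
  = (x \in mismatch D D').
Proof.
rewrite !inE partnerK; congr negb; apply/eqP/eqP => [e|<-];
  last by rewrite partnerK.
by rewrite -{1}e partnerK.
Qed.

(** When the partners of x lie in the same row, the transposition exchanging
    them preserves rows, and [recouple] repairs x without touching a node where
    the diagrams already agree. *)
Lemma same_orbit_reduce D D' x :
  x \in mismatch D D' -> is_upper (D x) = is_upper (D' x) ->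
  exists2 D1, same_orbit D D1 & (#|mismatch D1 D'| < #|mismatch D D'|)%N.
Proof.
move=> xm up; exists (recouple D x (D' x)); first exact: same_orbit_tperm.
apply/proper_card/properP; split; last first.
  by exists x; rewrite // inE negbK recouplel ?partner_neq.
apply/subsetP => w; rewrite !inE; apply: contra => /eqP wm.
rewrite -wm recouple_other // !inE !negb_or.
have nw y : y \in mismatch D D' -> w != y.
  by apply: contraTneq => <-; rewrite inE wm eqxx.
by rewrite !nw ?mismatch_partner ?mismatch_partner' ?xm.
Qed.

(** If the sets of upper nodes on horizontal arcs agree, some mismatched node
    has its two partners in the same row.  If not, they have the same size, so
    each contains a node missing from the other; exchanging these two upper
    nodes creates no mismatch, and either repairs one or makes the previous
    lemma applicable. *)
Lemma same_orbit_align D D' : #|cups D| = #|cups D'| -> D != D' ->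
  exists2 D1, same_orbit D D1 & (#|mismatch D1 D'| < #|mismatch D D'|)%N.
Proof.
move=> cDD' nDD'.
have [cE|cN] := eqVneq (cups D) (cups D').
  have up i : is_upper (D (inl i)) = is_upper (D' (inl i)).
    by move/setP/(_ i): cE; rewrite !inE.
  have [x xm] : exists x, x \in mismatch D D'.
    apply/set0Pn; apply: contraNneq nDD' => m0; apply/eqP/diagramP => x.
    by move/setP/(_ x): m0; rewrite !inE => /negbFE/eqP.
  have red i : inl i \in mismatch D D' ->
      exists2 D1, same_orbit D D1 & (#|mismatch D1 D'| < #|mismatch D D'|)%N.
    by move=> im; apply: same_orbit_reduce im _; apply: up.
  have [ux|] := boolP (is_upper x); first by apply: (red (position x));
    rewrite -upperE.
  have [ux _|lx _] := boolP (is_upper (D x)).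
    by apply: (red (position (D x))); rewrite -upperE // mismatch_partner.
  have [ux|lx'] := boolP (is_upper (D' x)).
    by apply: (red (position (D' x))); rewrite -upperE // mismatch_partner'.
  by apply: (same_orbit_reduce xm); rewrite (negPf lx) (negPf lx').
have /subsetPn[a aD aD'] : ~~ (cups D \subset cups D').
  by apply: contra cN => sub; rewrite eqEcard sub cDD' leqnn.
have /subsetPn[b bD' bD] : ~~ (cups D' \subset cups D).
  by apply: contra cN => sub; rewrite eq_sym eqEcard sub cDD' leqnn.
move: aD aD' bD bD'; rewrite !inE => aD aD' bD bD'.
have am : inl a \in mismatch D D'.
  by rewrite inE; apply: contraTneq aD => ->.
have bm : inl b \in mismatch D D'.
  by rewrite inE; apply: contraTneq bD' => <-.
(* After exchanging a and b the partners of a lie in the same row. *)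
pose D2 := relabel (tperm (inl a) (inl b)) D.
have o2 : same_orbit D D2 by apply: same_orbit_tperm.
have sub : mismatch D2 D' \subset mismatch D D'.
  apply/subsetP => w; rewrite !inE; apply: contra => /eqP wm.
  have nw y : y \in mismatch D D' -> y != w.
    by apply: contraTneq => ->; rewrite inE wm eqxx.
  have inv := inv_eq (@partnerK _ D).
  by rewrite -wm relabel_fixed tpermD // ?nw // eq_sym inv eq_sym nw
    ?mismatch_partner.
have D2a : D2 (inl a) = D (inl b).
  rewrite -[X in D2 X](tpermR (inl a) (inl b)) relabelE tpermD //.
    by apply: contraNneq bD => <-.
  by apply: contraNneq bD => <-.
have [D2a'|D2a'] := eqVneq (D2 (inl a)) (D' (inl a)).
  exists D2 => //; apply/proper_card/properP; split=> //.
  by exists (inl a); rewrite // inE D2a' eqxx.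
have am2 : inl a \in mismatch D2 D' by rewrite inE.
have [|D1 o1 lt1] := same_orbit_reduce am2;
  first by rewrite D2a (negPf bD) (negPf aD').
exists D1; first exact: same_orbit_trans o2 o1.
exact: leq_trans lt1 (subset_leq_card sub).
Qed.

Lemma same_orbitP D D' : #|cups D| = #|cups D'| -> same_orbit D D'.
Proof.
have [m] := ubnP #|mismatch D D'|; elim: m D => // m IH D lt cE.
have [->|nDD'] := eqVneq D D'; first exact: same_orbit_refl.
have [D1 o1 lt1] := same_orbit_align cE nDD'.
have cE1 : #|cups D1| = #|cups D'| by case: o1 => st <-; rewrite cups_relabel.
by apply: same_orbit_trans o1 (IH _ _ cE1); apply: leq_trans lt1 _.
Qed.

End Transitivity.

(** * Counting diagrams and the pairs of permutations that produce them *)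

Section Counting.
Local Open Scope nat_scope.
Variable r : nat.
Implicit Types (D : diagram r) (x y z : node r).

Definition with_cups k := [set D : diagram r | #|cups D| == k.*2].

(** The order of the stabiliser in Sym_r x Sym_r of a diagram with k arcs in
    each row, and the denominator in [Phi]. *)
Definition stab_order k := (2 ^ k * k`!) ^ 2 * (r - 2 * k)`!.

Lemma card_with_cups0 : #|with_cups 0| = r`!.
Proof.
rewrite -card_Sn -(card_imset _ (@perm_diagram_inj r)).
apply: eq_card => D; rewrite !inE cards_eq0; apply/eqP/imsetP =>
  [/cups_eq0[s ->]|[s _ ->]].
  by exists s.
exact: cups_perm.
Qed.

Lemma sum_upper (A : {set 'I_r}) : \sum_(x : node r | is_upper x &&
  (position x \in A)) 1 = #|A|.
Proof.
rewrite -sum1_card big_sumType /= [X in _ + X]big_pred0 // addn0.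
by apply: eq_bigl.
Qed.

Lemma sum_lower (A : {set 'I_r}) : \sum_(x : node r | ~~ is_upper x &&
  (position x \in A)) 1 = #|A|.
Proof.
rewrite -sum1_card big_sumType /= [X in X + _]big_pred0 // add0n.
Qed.

(** A pair (D, z) on the left is a diagram with an oriented upper arc starting
    at [a] and an oriented lower arc starting at z; recoupling turns both into
    vertical arcs at two ordered upper nodes. *)
Lemma card_with_cupsS_recouple a k :
  \sum_(q : diagram r * node r | (q.2 != inl a) &&
     [&& q.1 \in with_cups k.+1, a \in cups q.1,
       ~~ is_upper q.2 & ~~ is_upper (q.1 q.2)]) 1 =
  \sum_(q : diagram r * node r | (q.2 != inl a) &&
     [&& q.1 \in with_cups k, a \notin cups q.1,
       is_upper q.2 & ~~ is_upper (q.1 q.2)]) 1.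
Proof.
rewrite (recouple_big _ (inl a) (fun D z => [&& D \in with_cups k.+1,
  a \in cups D,
  ~~ is_upper z & ~~ is_upper (D z)]) (fun _ _ => 1)).
apply: eq_bigl => -[D z] /=; have [->|za] /= := eqVneq z (inl a); first by [].
rewrite !inE recouplel // recoupler //.
have [uDa|/lowerE lDa] := boolP (is_upper (D (inl a)));
  first by rewrite /= !andbF.
have [uz|] := boolP (is_upper z); last by rewrite !andbF.
have [|/lowerE lDz] := boolP (is_upper (D z)); first by rewrite !andbF.
move: za lDz; rewrite (upperE uz) => ba lDb.
rewrite (cups_recouple_vertical _ lDa lDb) ?doubleS //.
by rewrite eq_sym; apply: contra ba => /eqP->.
Qed.

Lemma card_with_cupsS k :
  #|with_cups k.+1| * (k.+1.*2 * k.+1.*2)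
    = #|with_cups k| * ((r - k.*2) * (r - k.*2).-1).
Proof.
have split (Q : diagram r -> node r -> bool) :
    \sum_(q : diagram r * node r | Q q.1 q.2) 1 = \sum_D \sum_(z | Q D z) 1.
  by rewrite pair_big_dep.
have lhs a : \sum_(q : diagram r * node r | (q.2 != inl a) &&
     [&& q.1 \in with_cups k.+1, a \in cups q.1,
       ~~ is_upper q.2 & ~~ is_upper (q.1 q.2)]) 1
   = \sum_(D in with_cups k.+1) (a \in cups D) * k.+1.*2.
  rewrite (split (fun D z => (z != inl a) && [&& D \in with_cups k.+1,
    a \in cups D,
     ~~ is_upper z & ~~ is_upper (D z)])) [RHS]big_mkcond.
  apply: eq_bigr => D _; case: ifP => [Dk|Dk]; last by rewrite big1 // => z;
    rewrite andbF.
  have [aD|aD] := boolP (a \in cups D); last by rewrite big1 // => z;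
    rewrite andbF.
  move: Dk; rewrite mul1n inE card_cups => /eqP <-; rewrite -sum_lower.
  apply: eq_bigl => -[] i; first by rewrite andbF.
  by rewrite /= inE.
have rhs a : \sum_(q : diagram r * node r | (q.2 != inl a) &&
     [&& q.1 \in with_cups k, a \notin cups q.1,
       is_upper q.2 & ~~ is_upper (q.1 q.2)]) 1
   = \sum_(D in with_cups k) (a \in ~: cups D) * (r - k.*2).-1.
  rewrite (split (fun D z => (z != inl a) && [&& D \in with_cups k,
    a \notin cups D,
     is_upper z & ~~ is_upper (D z)])) [RHS]big_mkcond.
  apply: eq_bigr => D _; case: ifP => [Dk|Dk]; last by rewrite big1 // => z;
    rewrite andbF.
  have [aD|aD] := boolP (a \in cups D); last first.
    rewrite inE aD mul1n.
    have -> : (r - k.*2).-1 = #|~: cups D :\ a|.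
      move: Dk; rewrite inE => /eqP <-.
      have := cardsC (cups D); rewrite card_ord (cardsD1 a (~: _)) inE aD => e.
      by rewrite -[X in X - _]e addKn add1n.
    rewrite -sum_upper; apply: eq_bigl => -[] i; last by rewrite andbF.
    by rewrite /= !inE.
  by rewrite inE aD mul0n big1 // => z; rewrite andbF.
have : \sum_a \sum_(D in with_cups k.+1) (a \in cups D) * k.+1.*2
    = \sum_a \sum_(D in with_cups k) (a \in ~: cups D) * (r - k.*2).-1.
  by apply: eq_bigr => a _; rewrite -lhs -rhs card_with_cupsS_recouple.
have count (A : {set 'I_r}) c : \sum_(a : 'I_r) (a \in A) * c = #|A| * c.
  by rewrite -big_distrl /= -sum1_card [in RHS]big_mkcond.
rewrite exchange_big [RHS]exchange_big /=.
rewrite (eq_bigr (fun=> k.+1.*2 * k.+1.*2)) => [|D];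
  last by rewrite inE count => /eqP->.
rewrite sum_nat_const => ->; rewrite -sum_nat_const; apply: eq_bigr => D.
by rewrite count inE => /eqP Dk; rewrite cardsCs setCK card_ord Dk.
Qed.

(** The recurrence for the number of diagrams matches that of [stab_order], so
    their product does not depend on k; for k = 0 the diagrams are the
    permutations. *)
Lemma card_with_cups k : 2 * k <= r -> #|with_cups k| * stab_order k
  = (r`!) ^ 2.
Proof.
elim: k => [|k IH] kr; first by rewrite card_with_cups0 /stab_order muln0 subn0
  expn0 fact0 mul1n exp1n mul1n mulnn.
rewrite -IH; last by apply: leq_trans kr; rewrite leq_mul2l leqnSn orbT.
have := card_with_cupsS k; rewrite /stab_order.
have [m mE] : exists m, r - k.*2 = m.+2 by exists (r - k.*2).-2; lia.
have -> : r - 2 * k = m.+2 by lia.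
have -> : r - 2 * k.+1 = m by lia.
rewrite mE !factS -!mulnn (expnS 2).
move: #|_| #|_| (2 ^ k) (k`!) (m`!) => a b c d e.
rewrite -!mul2n /= => h.
transitivity (b * (2 * k.+1 * (2 * k.+1)) * (c * d * (c * d) * e));
  first by lia.
by rewrite h; lia.
Qed.

Definition orbit_count D D' :=
  #|[set st : 'S_r * 'S_r | relabel (rows_perm st.1 st.2) D == D']|.

Lemma orbit_count_const D D1 D2 : #|cups D1| = #|cups D2| ->
  orbit_count D D1 = orbit_count D D2.
Proof.
suff le D' D'' : #|cups D'| = #|cups D''| ->
  orbit_count D D' <= orbit_count D D''.
  by move=> e; apply/eqP; rewrite eqn_leq !le.
move=> /same_orbitP[[u v] /= <-].
pose f (st : 'S_r * 'S_r) := (st.1 * u, st.2 * v)%g.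
have f_inj : injective f by move=> [s t] [s' t'] [/mulIg-> /mulIg->].
rewrite /orbit_count -(card_imset _ f_inj); apply/subset_leq_card/subsetP.
move=> _ /imsetP[[s t] + ->]; rewrite !inE /= => /eqP <-.
by rewrite relabelM rows_permM.
Qed.

(** By transitivity the (r!)^2 pairs of permutations are spread evenly over the
    class of [D]. *)
Lemma orbit_count_with_cups k D D' : 2 * k <= r ->
  D \in with_cups k -> D' \in with_cups k -> orbit_count D D' = stab_order k.
Proof.
move=> kr Dk D'k.
have N0 : 0 < #|with_cups k| by apply/card_gt0P; exists D.
apply/eqP; rewrite -(eqn_pmul2l N0) card_with_cups //.
rewrite -sum_nat_const (eq_bigr (orbit_count D)) => [|D'' D''k]; last first.
  by apply: orbit_count_const; move: D'k D''k; rewrite !inE => /eqP-> /eqP->.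
rewrite -card_Sn -mulnn -card_prod -sum1_card.
rewrite (partition_big (fun st => relabel (rows_perm st.1 st.2) D)
  (mem (with_cups k))) /=.
  by apply/eqP/eq_bigr => D'' _; rewrite /orbit_count -sum1dep_card.
by move=> [s t] _; rewrite inE cups_relabel; move: Dk; rewrite inE.
Qed.

Lemma orbit_count0 D D' : #|cups D| != #|cups D'| -> orbit_count D D' = 0.
Proof.
move=> ne; apply: eq_card0 => -[s t]; rewrite !inE /=; apply: contraNF ne =>
  /eqP <-.
by rewrite cups_relabel.
Qed.

End Counting.

(** * The sum of all diagrams *)

Section BrauerProducts.
Variables (K : fieldType) (delta : K) (r : nat).
Local Notation B := (brauer delta r).
Local Notation dg := (@of_diagram K delta r).
Implicit Types (D : diagram r) (s t : 'S_r) (x y : B).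

Lemma mul_diagram D1 D2 :
  dg D1 * dg D2 = delta ^+ loops D1 D2 *: dg (compose D1 D2).
Proof. exact: brauer_mul_diagram. Qed.

Lemma mul_perm s D : dg (perm_diagram s) * dg D
  = dg (relabel (rows_perm s 1%g) D).
Proof. by rewrite mul_diagram loops_perm compose_perm scale1r. Qed.

Lemma mul_permr s D :
  dg D * dg (perm_diagram s) = dg (relabel (rows_perm 1%g s^-1%g) D).
Proof. by rewrite mul_diagram loops_permr compose_permr scale1r. Qed.

Lemma mul_cupcap a b D : a != b -> dg (cupcap_diagram a b) * dg D
  = delta ^+ (D (inl a) == inl b) *: dg (recouple D (inl a) (inl b)).
Proof. by move=> ab; rewrite mul_diagram loops_cupcap // compose_cupcap. Qed.

Lemma mul_cupcapr a b D : a != b -> dg D * dg (cupcap_diagram a b)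
  = delta ^+ (D (inr a) == inr b) *: dg (recouple D (inr a) (inr b)).
Proof. by move=> ab; rewrite mul_diagram loops_cupcapr // compose_cupcapr. Qed.

Lemma mul_perm_diagram s t :
  dg (perm_diagram s) * dg (perm_diagram t) = dg (perm_diagram (t * s)%g).
Proof.
rewrite mul_perm; congr of_diagram; apply: diagramP => x.
rewrite -[x](permKV (rows_perm s 1%g)) relabelE.
case: (_ x) => i; rewrite !ffunE /= ?rows_perml ?rows_permr ?perm1 /=.
 by rewrite invMg permM permK.
by rewrite permM.
Qed.

Lemma conj_cupcap s a b :
  dg (perm_diagram s) * dg (cupcap_diagram a b) * dg (perm_diagram s^-1%g)
  = dg (cupcap_diagram (s a) (s b)).
Proof.
rewrite mul_perm mul_permr invgK relabelM rows_permM mulg1 mul1g.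
congr of_diagram; apply: diagramP => x.
rewrite -[x](permKV (rows_perm s s)) relabelE.
case: (_ x) => i; rewrite ffunE /= ?rows_perml ?rows_permr ffunE /=;
  rewrite -(inj_tperm _ _ _ (@perm_inj _ s)) (inj_eq (@perm_inj _ s));
  by case: ifP => _; rewrite ?rows_perml ?rows_permr.
Qed.

(** If D joins the upper nodes a and b, placing e on top of D only creates a
    loop, which an invertible delta allows to cancel.  This writes any diagram
    other than a permutation as a multiple of itself with a factor e. *)
Lemma diagram_absorbl D : delta != 0 -> cups D != set0 ->
  exists a b, a != b /\ dg D = delta^-1 *: (dg (cupcap_diagram a b) * dg D).
Proof.
move=> d0 /set0Pn[a]; rewrite inE => /upperE Da.
exists a, (position (D (inl a))).
have ab : a != position (D (inl a)).
  by have := partner_neq D (inl a); rewrite Da eq_sym.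
by rewrite mul_cupcap // -Da eqxx recouple_partner scalerA mulVf ?scale1r.
Qed.

Lemma diagram_absorbr D : delta != 0 -> cups D != set0 ->
  exists a b, a != b /\ dg D = delta^-1 *: (dg D * dg (cupcap_diagram a b)).
Proof.
move=> d0 /set0Pn[? /cups_caps_neq0[a]]; rewrite inE => /lowerE Da.
exists a, (position (D (inr a))).
have ab : a != position (D (inr a)).
  by have := partner_neq D (inr a); rewrite Da eq_sym.
by rewrite mul_cupcapr // -Da eqxx recouple_partner scalerA mulVf ?scale1r.
Qed.

Definition diagram_sum : B := \sum_D dg D.

Lemma card_other_nodes (u v : node r) : u != v ->
  #|[pred w | (w != u) && (w != v)]| = (2 * r.-1)%N.
Proof.
move=> uv; rewrite (eq_card (B := predC (pred2 u v))).
  have := cardC (pred2 u v); rewrite card2 uv card_sum card_ord /=.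
  by move: #|_| => m; lia.
by move=> w; rewrite !inE negb_or.
Qed.

(** A fixed diagram D with D u = v is the recoupling of itself, with weight
    delta, and of one diagram of weight 1 for each node other than u and v. *)
Lemma recouple_diagram_sum (u v : node r) : u != v ->
  \sum_(D : diagram r) delta ^+ (D u == v) *: dg (recouple D u v)
  = (delta + (2 * r.-1)%:R) *: \sum_(D : diagram r | D u == v) dg D.
Proof.
move=> uv; pose F D w : B := delta ^+ (D u == w) *: dg (recouple D u w).
transitivity (\sum_(q : diagram r * node r | (q.2 != u) && (q.2 == v)) F q.1
  q.2).
  rewrite -(pair_big_dep xpredT (fun D w => (w != u) && (w == v)) F) /=.
  apply: eq_bigr => D _; rewrite (big_pred1 v) // => w /=.
  by have [->|_] := eqVneq w v; rewrite ?andbF // andbT eq_sym.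
rewrite (recouple_big _ u (fun _ w => w == v) F).
rewrite (eq_bigl (fun q : diagram r * node r => (q.1 u == v) && (q.2 != u)));
  last first.
  by move=> q; rewrite andbC.
pose G D w : B := delta ^+ (w == v) *: dg D.
rewrite (eq_bigr (fun q => G q.1 q.2)) => [|[D w] /= /andP[/eqP Du wu]];
  last first.
  by rewrite /F /G recouplel // recoupleK // Du.
rewrite -(pair_big_dep (fun D => D u == v) (fun D w =>
  w != u) G) /= scaler_sumr.
apply: eq_bigr => D _; rewrite -scaler_suml; congr (_ *: _).
rewrite (bigD1 v) 1?eq_sym //= eqxx expr1; congr (_ + _).
rewrite (eq_bigr (fun=> 1)) => [|w /andP[_ /negPf-> //]].
by rewrite sumr_const card_other_nodes.
Qed.

Lemma perm_diagram_sum s : dg (perm_diagram s) * diagram_sum = diagram_sum.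
Proof.
rewrite mulr_sumr [RHS](reindex_inj (can_inj (relabelK (rows_perm s 1%g)))).
by apply: eq_bigr => D _; rewrite mul_perm.
Qed.

Lemma diagram_sum_perm s : diagram_sum * dg (perm_diagram s) = diagram_sum.
Proof.
rewrite mulr_suml [RHS](reindex_inj (can_inj (relabelK
  (rows_perm 1%g s^-1%g)))).
by apply: eq_bigr => D _; rewrite mul_permr.
Qed.

Section SpecialParameter.
Hypotheses (deltaE : delta = - (2 * r.-1)%:R) (delta_neq0 : delta != 0).

Lemma cupcap_diagram_sum a b : a != b ->
  dg (cupcap_diagram a b) * diagram_sum = 0.
Proof.
move=> ab; rewrite mulr_sumr (eq_bigr _ (fun D _ => mul_cupcap D ab)).
by rewrite recouple_diagram_sum // deltaE addNr scale0r.
Qed.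

Lemma diagram_sum_cupcap a b : a != b ->
  diagram_sum * dg (cupcap_diagram a b) = 0.
Proof.
move=> ab; rewrite mulr_suml (eq_bigr _ (fun D _ => mul_cupcapr D ab)).
by rewrite recouple_diagram_sum // deltaE addNr scale0r.
Qed.

Lemma mul_diagram_sum D : dg D * diagram_sum
  = (cups D == set0)%:R *: diagram_sum.
Proof.
have [/cups_eq0[s ->]|cD] := eqVneq (cups D) set0.
  by rewrite perm_diagram_sum scale1r.
have [a [b [ab ->]]] := diagram_absorbr delta_neq0 cD.
by rewrite -scalerAl -mulrA cupcap_diagram_sum // mulr0 scaler0 scale0r.
Qed.

Lemma diagram_sum_mul D : diagram_sum * dg D
  = (cups D == set0)%:R *: diagram_sum.
Proof.
have [/cups_eq0[s ->]|cD] := eqVneq (cups D) set0.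
  by rewrite diagram_sum_perm scale1r.
have [a [b [ab ->]]] := diagram_absorbl delta_neq0 cD.
by rewrite -scalerAr mulrA diagram_sum_cupcap // mul0r scaler0 scale0r.
Qed.

End SpecialParameter.
End BrauerProducts.

(** * The trivial representation *)

Section TrivialRepresentation.
Variables (K : fieldType) (delta : K) (r : nat).
Local Notation B := (brauer delta r).
Local Notation dg := (@of_diagram K delta r).
Implicit Types (D : diagram r) (s t : 'S_r) (x y : B).

(** The sum runs over the permutations, which are the diagrams without
    horizontal arcs. *)
Definition perm_weight x : K := \sum_(D | cups D == set0) x D.
Definition trivial_rep x : 'M[K]_1 := (perm_weight x)%:M.

Lemma trivial_rep_linear : linear trivial_rep.
Proof.
move=> c x y; rewrite /trivial_rep scale_scalar_mx -raddfD /=; congr _%:M.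
rewrite /perm_weight mulr_sumr -big_split; apply: eq_bigr => D _ /=.
by rewrite !ffunE.
Qed.

HB.instance Definition _ :=
  GRing.isLinear.Build K B 'M[K]_1 _ trivial_rep trivial_rep_linear.

Lemma trivial_rep_diagram D : trivial_rep (dg D) = (cups D == set0)%:R.
Proof.
rewrite /trivial_rep -[RHS](raddfMn (scalar_mx)) /perm_weight.
have [c0|nc] := eqVneq (cups D) set0.
  rewrite (bigD1 D) ?c0 //= ffunE eqxx big1 ?addr0 // => D' /andP[_ nD].
  by rewrite ffunE (negPf nD).
rewrite big1 // => D' c0; rewrite ffunE; case: eqP => // D'D.
by rewrite D'D (negPf nc) in c0.
Qed.

(** Arcs in the upper row of the top factor survive in a product.  So a
    product is not a permutation unless its top factor is one, in which case it
    is a relabelling of the other factor; this makes [trivial_rep]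
    multiplicative. *)
Lemma cups_compose (D1 D2 : diagram r) : cups D1 \subset cups (compose D1 D2).
Proof.
apply/subsetP => i; rewrite !inE => /upperE Di.
rewrite (@compose_uniq _ D1 D2 (inl i) (D1 (inl i))) ?partner_neq //.
  by rewrite Di.
by have := connect_above D1 D2 (inl i); rewrite Di.
Qed.

Lemma trivial_rep_monoid_morphism : monoid_morphism trivial_rep.
Proof.
split; first by rewrite -[1](erefl (dg (id_diagram r))) trivial_rep_diagram
  cups_perm eqxx.
move=> x y; elim/brauer_ind: x => [D1|a x x' IH IH'|]; last first.
- by rewrite mul0r linear0 mul0r.
- by rewrite mulrDl -scalerAl !linearP /= IH IH' mulrDl -scalerAl.
elim/brauer_ind: y => [D2|a y y' IH IH'|]; last first.
- by rewrite mulr0 linear0 mulr0.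
- by rewrite mulrDr -scalerAr !linearP /= IH IH' mulrDr -scalerAr.
have [/cups_eq0[s ->]|c1] := eqVneq (cups D1) set0.
  rewrite mul_perm !trivial_rep_diagram cups_perm eqxx mul1r.
  by rewrite -!cards_eq0 cups_relabel.
rewrite mul_diagram linearZ /= !trivial_rep_diagram (negPf c1) mul0r.
case: eqVneq => [c0|_]; last by rewrite scaler0.
by case/negP: c1; rewrite -subset0 -c0 cups_compose.
Qed.

HB.instance Definition _ :=
  GRing.isMonoidMorphism.Build B 'M[K]_1 trivial_rep
    trivial_rep_monoid_morphism.

End TrivialRepresentation.

(** * Phi is the sum of all diagrams *)

Section PhiSum.
Variables (K : fieldType) (delta : K) (n : nat).
Local Notation B := (brauer delta n.+1).
Local Notation dg := (@of_diagram K delta n.+1).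

Lemma sym_sum_conj D : sym_sum delta n * dg D * sym_sum delta n
  = \sum_(D' : diagram n.+1) (orbit_count D D')%:R *: dg D'.
Proof.
pose F (st : 'S_n.+1 * 'S_n.+1) := relabel (rows_perm st.1 st.2) D.
transitivity (\sum_(st : 'S_n.+1 * 'S_n.+1) dg (F st)).
  have -> : sym_sum delta n * dg D = \sum_s dg (perm_diagram s) * dg D.
    exact: mulr_suml.
  rewrite -(pair_big xpredT xpredT (fun s t => dg (F (s, t)))) mulr_suml /=.
  apply: eq_bigr => s _; rewrite mulr_sumr (reindex_inj invg_inj).
  apply: eq_bigr => t _; rewrite mul_perm mul_permr invgK relabelM rows_permM.
  by rewrite mulg1 mul1g.
rewrite (partition_big F xpredT) //=; apply: eq_bigr => D' _.
rewrite (eq_bigr (fun=> dg D')) => [|st /eqP-> //].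
by rewrite sumr_const scaler_nat /orbit_count cardsE.
Qed.

(** No loops arise in E(k): each new factor acts on two columns still carrying
    vertical arcs, which the last clause keeps track of. *)
Lemma e_prod_diagram k : (2 * k <= n.+1)%N -> exists D : diagram n.+1,
  [/\ e_prod delta n k = dg D, D \in with_cups _ k
    & forall i : 'I_n.+1, (i < n.+1 - 2 * k)%N -> D (inr i) = inl i].
Proof.
elim: k => [|k IH] kn.
  exists (id_diagram n.+1); split; first by rewrite /e_prod big_nil.
    by rewrite inE cups_perm cards0.
  by move=> i _; rewrite ffunE /= perm1.
have [|D [De Dk Dv]] := IH; first by lia.
pose a : 'I_n.+1 := inord (n - 2 * k).-1; pose b : 'I_n.+1 := inord (n - 2 * k).
have aE : a = (n - 2 * k).-1 :> nat by rewrite inordK //; lia.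
have bE : b = (n - 2 * k)%N :> nat by rewrite inordK //; lia.
have ab : a != b by rewrite -val_eqE /= aE bE; lia.
have Da : D (inr a) = inl a by apply: Dv; rewrite aE; lia.
have Db : D (inr b) = inl b by apply: Dv; rewrite bE; lia.
exists (recouple D (inr a) (inr b)); split.
- rewrite /e_prod big_nat_recr //= -/(e_prod delta n k) De /e_gen.
  have -> : (n + 2 - 2 * k.+1 = n - 2 * k)%N by lia.
  by rewrite -/a -/b mul_cupcapr // Da scale1r.
- rewrite inE card_cups -cups_flip recouple_flip.
  rewrite (@cups_recouple_vertical _ _ a b a b) // ?flipE /= ?Da ?Db //.
  by rewrite cups_flip -card_cups; move: Dk; rewrite inE => /eqP->;
    rewrite doubleS.
- move=> i ilt; rewrite recouple_other; first by apply: Dv; lia.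
  rewrite !inE !negb_or Da Db /= andbT.
  by apply/andP; split; apply/eqP => -[] /(congr1 val) /=; rewrite ?aE ?bE; lia.
Qed.

Lemma Phi_sum_diagrams : [pchar K] =i pred0 ->
  \sum_(0 <= k < (n.+1)./2.+1)
    ((2 ^ k * k`!) ^ 2 * (n.+1 - 2 * k)`!)%:R^-1
      *: (sym_sum delta n * e_prod _ n k * sym_sum _ n)
        = diagram_sum delta n.+1.
Proof.
move=> /pcharf0P char0; rewrite /diagram_sum.
transitivity (\sum_(0 <= k < (n.+1)./2.+1) \sum_(D in with_cups n.+1 k) dg D).
  apply: eq_big_nat => k /andP[_ kn].
  have kn' : (2 * k <= n.+1)%N by lia.
  have [E [-> Ek _]] := e_prod_diagram kn';
    rewrite sym_sum_conj scaler_sumr [RHS]big_mkcond.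
  apply: eq_bigr => D _; case: ifP => [Dk|Dk].
    rewrite (orbit_count_with_cups kn' Ek Dk) /stab_order scalerA mulVf
      ?scale1r //.
    by rewrite char0 -lt0n muln_gt0 fact_gt0 expn_gt0 muln_gt0 expn_gt0
      fact_gt0.
  rewrite orbit_count0 ?scale0r ?scaler0 //.
  by move: Ek Dk; rewrite !inE => /eqP->; rewrite eq_sym => ->.
pose p (D : diagram n.+1) : 'I_(n.+1)./2.+1 := inord #|cups D|./2.
rewrite big_mkord (partition_big p xpredT) //=; apply: eq_bigr => k _.
apply: eq_bigl => D; rewrite inE -val_eqE /= inordK; last first.
  by rewrite ltnS (@half_leq _ n.+1) // -[X in (_ <= X)%N](card_ord n.+1)
    max_card.
by rewrite -{1}(odd_double_half #|cups D|) (negPf (even_cups D))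
  (inj_eq double_inj).
Qed.

End PhiSum.

(** * Uniqueness of the trivial representation *)

Section TrivialRepresentationUnique.
Variables (K : fieldType) (delta : K) (n : nat).
Local Notation B := (brauer delta n.+1).
Local Notation dg := (@of_diagram K delta n.+1).

Lemma trivial_representation_trivial_rep :
  trivial_representation (trivial_rep (delta := delta) (r := n.+1)).
Proof.
move=> i /andP[i1 iN]; split; apply: etrans (trivial_rep_diagram _ _) _.
  by rewrite cups_perm eqxx.
have ab : inord i.-1 != inord i :> 'I_n.+1.
  by rewrite -val_eqE /= !inordK; lia.
by case: eqP => // /setP/(_ (inord i.-1)); rewrite !inE cupcapl.
Qed.

Variable rho : representation B 0.
Hypotheses (n_ge1 : (1 <= n)%N) (delta_neq0 : delta != 0).
Hypothesis rhoT : trivial_representation rho.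

(** Adjacent transpositions generate all transpositions by conjugation, and
    these generate the symmetric group. *)
Lemma trivial_representation_perm s : rho (dg (perm_diagram s)) = 1.
Proof.
pose P t := rho (dg (perm_diagram t)) = 1.
have PM t u : P t -> P u -> P (t * u)%g.
  by rewrite /P -mul_perm_diagram rmorphM /= => -> ->; rewrite mulr1.
have Padj i : (i < n)%N -> P (tperm (inord i) (inord i.+1)).
  by move=> lt; have [] := rhoT (i := i.+1) lt.
have Ptp i j : (i < j <= n)%N -> P (tperm (inord i) (inord j)).
  elim: j => // j IH /andP[ij jn]; have [<-|nij] := eqVneq i j;
    first by apply: Padj; lia.
  have -> : tperm (inord i) (inord j.+1) =
      (tperm (inord i) (inord j) ^ tperm (inord j) (inord j.+1))%g :> 'S_n.+1.
    rewrite tpermJ tpermL tpermD // -val_eqE /= !inordK; lia.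
  rewrite conjgE tpermV; apply: (PM); first by apply: Padj; lia.
  by apply: (PM); [apply: IH|apply: Padj]; lia.
have [ts -> ] := prod_tpermP s => dts.
rewrite -/(P _) big_seq; elim/big_ind: _ => [|s1 s2|[i j] /(allP dts)] /=.
- exact: rmorph1.
- exact: PM.
rewrite /dpair /= => ij; rewrite -[i]inord_val -[j]inord_val.
have [lt|] := ltnP i j; first by apply: Ptp; rewrite lt -ltnS ltn_ord.
rewrite leq_eqVlt eq_sym (inj_eq val_inj) (negPf ij) /= => lt.
by rewrite tpermC; apply: Ptp; rewrite lt -ltnS ltn_ord.
Qed.

(** All the diagrams e are conjugate under permutations to the first
    generator. *)
Lemma trivial_representation_cupcap a b : a != b ->
  rho (dg (cupcap_diagram a b)) = 0.
Proof.
move=> ab; pose x0 : 'I_n.+1 := inord 0; pose x1 : 'I_n.+1 := inord 1.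
have x01 : x0 != x1 by rewrite -val_eqE /= !inordK.
pose s := (tperm x0 a * tperm (tperm x0 a x1) b)%g.
have sx1 : s x1 = b by rewrite permM tpermL.
have sx0 : s x0 = a.
  rewrite permM tpermL tpermD 1?eq_sym //.
  by rewrite -{1}(tpermL x0 a) (inj_eq perm_inj).
rewrite -sx0 -sx1 -conj_cupcap !rmorphM /=.
by have [_ ->] := rhoT (i := 1%N) n_ge1; rewrite mulr0 mul0r.
Qed.

Lemma trivial_representation_unique : rho =1 trivial_rep (delta := delta)
  (r := n.+1).
Proof.
elim/brauer_ind => [D|c x y IH IH'|]; last by rewrite !linear0.
  rewrite trivial_rep_diagram.
  have [/cups_eq0[s ->]|cD] := eqVneq (cups D) set0.
    by rewrite trivial_representation_perm.
  have [a [b [ab ->]]] := diagram_absorbl delta_neq0 cD.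
  by rewrite linearZ rmorphM /= trivial_representation_cupcap // mul0r scaler0.
by rewrite !linearP /= IH IH'.
Qed.

End TrivialRepresentationUnique.

(** * The central idempotent *)

Theorem corollary5p4 (K : fieldType) (charK0 : [pchar K] =i pred0)
    (n : nat) (n_ge1 : (1 <= n)%N) :
  let z := ((n.+1)`!)%:R^-1 *: Phi K n in
  exists rho : representation (brauer (- (2 * n)%:R : K) n.+1) 0,
    [/\ trivial_representation rho,
        forall rho' : representation (brauer (- (2 * n)%:R : K) n.+1) 0,
          trivial_representation rho' -> rho' =1 rho,
        unique (central_idempotent_of rho) z
      & \dim (generated_ideal z) = 1%N].
Proof.
move=> z; set delta : K := - (2 * n)%:R.
have /pcharf0P char0 := charK0.
have delta0 : delta != 0 by rewrite oppr_eq0 char0 -lt0n muln_gt0.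
have zE : z = ((n.+1)`!)%:R^-1 *: diagram_sum delta n.+1.
  by rewrite -Phi_sum_diagrams.
pose rho : representation (brauer delta n.+1) 0 := trivial_rep (delta := delta)
  (r := n.+1).
have deltaE : delta = - (2 * n.+1.-1)%:R by [].
have rhoE D : rho (of_diagram delta D) 0 0 = (cups D == set0)%:R.
  have -> : rho (of_diagram delta D) = (cups D == set0)%:R by apply:
    trivial_rep_diagram.
  by case: (_ == _); rewrite mxE.
have lz a : a * z = rho a 0 0 *: z.
  rewrite zE -scalerAr scalerA mulrC -scalerA; congr (_ *: _).
  elim/brauer_ind: a => [D|c x y IH IH'|];
    last by rewrite linear0 mul0r mxE scale0r.
    by rewrite mul_diagram_sum // rhoE.
  by rewrite mulrDl -scalerAl IH IH' linearP !mxE scalerA -scalerDl.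
have rz a : z * a = rho a 0 0 *: z.
  rewrite zE -scalerAl scalerA mulrC -scalerA; congr (_ *: _).
  elim/brauer_ind: a => [D|c x y IH IH'|];
    last by rewrite linear0 mulr0 mxE scale0r.
    by rewrite diagram_sum_mul // rhoE.
  by rewrite mulrDr -scalerAr IH IH' linearP !mxE scalerA -scalerDl.
have rhoT : rho (diagram_sum delta n.+1) 0 0 = ((n.+1)`!)%:R.
  rewrite /diagram_sum linear_sum summxE (eq_bigr _ (fun D _ =>
    rhoE D)) -natr_sum.
  congr _%:R; rewrite -card_with_cups0 -sum1_card [RHS]big_mkcond.
  by apply: eq_bigr => D _; rewrite inE cards_eq0; case: eqP.
have rhoz : rho z = 1.
  by rewrite [LHS]mx11_scalar zE linearZ mxE rhoT mulVf // char0 -lt0n fact_gt0.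
exists rho; split.
- exact: trivial_representation_trivial_rep.
- by move=> rho' rho'T; apply: trivial_representation_unique.
- exact: eigenvector_central_idempotent_unique.
- exact: dim_generated_ideal rhoz.
Qed.
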